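(* For every $h\ge0$, $n\ge1$ and integer partitions $\alpha,\beta\vdash n$, \[ \vec H_h(\alpha,\beta)=\sum_{(\sigma,\tau)\in C_\alpha\times C_\beta}\ \sum_{L=0}^{h-g(\sigma,\tau^{-1})}\ \sum_{\substack{\pi\ge\Pi(\nu)\\ \Pi(\sigma,\tau)\vee\pi=1_n\\ \#(\nu)-|\pi|=|\Pi(\sigma,\tau)|+L-1}}\ \sum_{\substack{\{g_B\}_{B\in\pi}\ge0\\ \sum_Bg_B=h-g(\sigma,\tau^{-1})-L}}\ \prod_{B\in\pi}\frac{\vec H_{g_B}(c(\nu_B))}{|C_{c(\nu_B)}|}, \] where $\nu=\sigma\tau^{-1}$ (an empty sum being zero).
   Context: For $\alpha\vdash m$, $C_\alpha\subset S_m$ is the set of permutations of cycle type $\alpha$, $\#(\alpha)$ its number of parts. For $\sigma\in S_m$, $\#(\sigma)$ is the number of cycles, $\lVert\sigma\rVert=m-\#(\sigma)$. A sequence of transpositions $(p_1q_1),\dots,(p_lq_l)$ with $p_k<q_k$ has weakly monotone maxima if $q_1\le q_2\le\cdots\le q_l$. For $\sigma,\tau\in S_n$ and $l\ge0$, let $p_C[\sigma,\tau;l]$ be the number of sequences of $l$ transpositions $\mu_1,\dots,\mu_l$ with weakly monotone maxima such that $\sigma=\mu_1\cdots\mu_l\tau$ and the group generated by $\sigma,\tau,\mu_1,\dots,\mu_l$ is transitive on $\{1,\dots,n\}$. Monotone double Hurwitz numbers: $\vec H_h(\alpha,\beta)=\sum_{\sigma\in C_\alpha,\tau\in C_\beta}p_C[\sigma,\tau;\#(\alpha)+\#(\beta)+2h-2]$;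 monotone single Hurwitz numbers: for $\alpha\vdash m$, $\vec H_h(\alpha)=\sum_{\sigma\in C_\alpha}p_C[\sigma,\mathrm{id}_m;\#(\alpha)+m+2h-2]$. Set partitions of $\{1,\dots,n\}$: $\le$ refinement, $\vee$ join, $1_n$ one-block partition, $|\pi|$ number of blocks; $\Pi(\nu)$ the partition into cycles of $\nu$; $\Pi(\sigma,\tau)$ the orbit partition of the group generated by $\sigma,\tau$. For $\pi\ge\Pi(\nu)$ and $B\in\pi$, $\nu_B$ is the restriction of $\nu$ to $B$ and $c(\nu_B)\vdash|B|$ its cycle type. The genus $g(\sigma,\tau^{-1})$ is defined by $\#(\sigma)+\#(\tau)-n+\#(\sigma\tau^{-1})=2|\Pi(\sigma,\tau)|-2g(\sigma,\tau^{-1})$. *)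

(* Defs.v *)
From HB Require Import structures.
From mathcomp Require Import all_boot all_order all_algebra all_fingroup.

Set Implicit Arguments.
Unset Strict Implicit.
Unset Printing Implicit Defensive.

Import Order.TTheory GRing.Theory Num.Theory.

Local Open Scope group_scope.

Definition is_intpart (n : nat) (a : seq nat) : bool :=
  [&& sorted geq a, all (leq 1) a & sumn a == n].

Section Permutations.
Variable T : finType.
Implicit Types (s t nu : {perm T}) (B : {set T}) (P Q : {set {set T}}).

Definition ncycles s : nat := #|porbits s|.

Definition cycle_type s : seq nat :=
  sort geq [seq #|C| | C : {set T} <- enum (porbits s)].

(* Cycle type of the restriction of nu to a nu-stable set B. As restr_perm B nu
   is a permutation of T fixing every point outside B, only its cycles through
   points of B are listed. *)
Definition restr_cycle_type nu B : seq nat :=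
  sort geq [seq #|C| | C : {set T} <- enum (porbit (restr_perm B nu) @: B)].

Definition joint_orbits s t : {set {set T}} :=
  orbit 'P <<[set s; t]>> @: [set: T].

Definition refines P Q : bool :=
  [forall A in P, exists B in Q, A \subset B].

(* Classes of the equivalence relation generated by "same block of P" and
   "same block of Q". *)
Definition partition_join P Q : {set {set T}} :=
  equivalence_partition
    (connect [rel x y | (y \in pblock P x) || (y \in pblock Q x)]) [set: T].

Definition one_block_partition : {set {set T}} := [set [set: T]].

(* genus s u is g(s, u), the integer determined with t = u^-1 by
     #(s) + #(t) - #|T| + #(s t^-1) = 2 |Pi(s, t)| - 2 g(s, t^-1);
   the halving is exact, see genusP. *)
Definition genus s (u : {perm T}) : int :=
  (((2 * #|joint_orbits s u^-1%g|)%N%:Z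
    - ((ncycles s)%:Z + (ncycles u^-1%g)%:Z - #|T|%:Z + (ncycles (s * u)%g)%:Z))
     %/ 2)%Z%R.

Lemma genusP s t :
  ((ncycles s)%:Z + (ncycles t)%:Z - #|T|%:Z + (ncycles (s * t^-1)%g)%:Z
   = (2 * #|joint_orbits s t|)%N%:Z - 2 * genus s t^-1%g)%R.
Proof.
rewrite /genus invgK.
set x := (_ + _ - _ + _)%R; set y := Posz (2 * _).
suff /divzK dvdx : (2 %| (y - x)%R)%Z by rewrite mulrC dvdx subKr.
have even2 k : (2 %| Posz (2 * k))%Z by rewrite dvdzE dvdn_mulr.
apply: rpredB; first exact: even2.
rewrite /x; have := odd_permM s t^-1; rewrite odd_permV /odd_perm -!/(ncycles _).
move: (ncycles s) (ncycles t) (ncycles (s * t^-1)) #|T| => a b c d e.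
have -> : (a%:Z + b%:Z - d%:Z + c%:Z = (a + b + d + c)%N%:Z - (2 * d)%N%:Z)%R.
  by rewrite mul2n -addnn !PoszD opprD addrA (addrAC _ (Posz c)) addrK addrAC.
apply: rpredB; last exact: even2.
rewrite dvdzE /= dvdn2 !oddD.
by move: e; case: (odd a); case: (odd b); case: (odd c); case: (odd d).
Qed.

End Permutations.

Definition perm_class (n : nat) (a : seq nat) : {set 'S_n} :=
  [set s | cycle_type s == a].

Section Hurwitz.
Variable n : nat.

(* A transposition (p q) with p < q is encoded by the pair (p, q). *)
Definition transp (u : 'I_n * 'I_n) : 'S_n := tperm u.1 u.2.

Definition monotone_transps (mu : seq ('I_n * 'I_n)) : bool :=
  all (fun u : 'I_n * 'I_n => u.1 < u.2) mu
  && sorted (fun u v : 'I_n * 'I_n => u.2 <= v.2) mu.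

Definition p_C (s t : 'S_n) (l : nat) : nat :=
  #|[set mu : l.-tuple ('I_n * 'I_n) |
      [&& monotone_transps mu,
          s == (\prod_(u <- mu) transp u) * t &
          [transitive <<[set s; t] :|: [set transp u | u in mu]>>,
             on [set: 'I_n] | 'P]]]|.

(* The subtractions do not truncate for integer partitions of n >= 1. *)
Definition double_hurwitz (h : nat) (a b : seq nat) : nat :=
  (\sum_(s in perm_class n a) \sum_(t in perm_class n b)
     p_C s t (size a + size b + 2 * h - 2))%N.

Definition single_hurwitz (h : nat) (a : seq nat) : nat :=
  (\sum_(s in perm_class n a) p_C s 1%g (size a + n + 2 * h - 2))%N.

End Hurwitz.

(* The families (g_B)_{B in P} of natural numbers with sum k; the bound on the
   values is implied by the sum condition. *)
Definition genus_families (T : finType) (P : {set {set T}}) (k : int) :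
    {set {ffun {B : {set T} | B \in P} -> 'I_(`|k|%N).+1}} :=
  [set g : {ffun {B : {set T} | B \in P} -> 'I_(`|k|%N).+1} |
     Posz (\sum_(B : {B : {set T} | B \in P}) g B)%N == k].

(* Main.v *)
Require Import Defs.
From mathcomp Require Import all_boot all_order all_algebra all_fingroup.
From mathcomp Require Import zify.

Set Implicit Arguments.
Unset Strict Implicit.
Unset Printing Implicit Defensive.

Import Order.TTheory GRing.Theory Num.Theory.

(** Fix sigma, tau and nu = sigma tau^-1, and sort the monotone factorizations
    of nu by the orbit partition pi of their transpositions; transitivity then
    reads Pi(sigma, tau) \/ pi = 1_n. A monotone factorization with orbit
    partition pi is the same thing as one transitive monotone factorization of
    nu_B for each block B: transpositions with equal maxima lie in the same
    block, so sorting by maxima is the only way to interleave the pieces.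
    Relabelling B increasingly by 1, ..., |B| turns the number of pieces of
    length #(nu_B) + |B| + 2 g_B - 2 into p_C[nu_B, id; -]; by Riemann-Hurwitz
    no other lengths occur, and the total length fixes the sum of the g_B.

    The number p_C[nu, id; l] depends only on the cycle type of nu. It is the
    complete homogeneous sum h_l in the Jucys-Murphy elements
    X_j = \sum_(i < j) (i j), with the generated group recorded along with the
    product. Conjugation by (k k+1) fixes the other X_j and preserves both
    X_k + X_(k+1) and X_(k+1) X_k, by the braid relations
    s t = t (s ^ t), which respect products as well as generated groups. *)

(** * Components of graphs and products of transpositions *)

Section Components.
Local Open Scope group_scope.
Variable T : finType.
Implicit Types (s : {perm T}) (e : rel T) (E w : seq (T * T)) (P Q : {set {set T}}).

Definition edge_rel E : rel T := [rel x y | ((x, y) \in E) || ((y, x) \in E)].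

Lemma edge_rel_sym E : symmetric (edge_rel E).
Proof. by move=> x y; rewrite /edge_rel /= orbC. Qed.

Lemma edge_connect_sym E : connect_sym (edge_rel E).
Proof. exact/sym_connect_sym/edge_rel_sym. Qed.

Lemma card_classes (rT : finType) (f : T -> rT) e :
    connect_sym e -> (forall x y, (f x == f y) = connect e x y) ->
  #|f @: [set: T]| = n_comp e T.
Proof.
move=> sym_e f_eq; have -> : f @: [set: T] = f @: [set x | roots e x].
  apply/setP=> y; apply/imsetP/imsetP=> -[x _ ->]; last by exists x.
  exists (fingraph.root e x); first by rewrite inE roots_root.
  by apply/eqP; rewrite f_eq connect_root.
rewrite card_in_imset; last first.
  move=> x y; rewrite !inE => /eqP rx /eqP ry /eqP; rewrite f_eq.
  by move/(fingraph.rootP sym_e); rewrite rx ry.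
by rewrite cardsE /n_comp_mem; apply: eq_card => x; rewrite !inE andbT.
Qed.

Lemma eq_pblockT P x y : partition P [set: T] ->
  (pblock P x == pblock P y) = (y \in pblock P x).
Proof.
move=> partP; case/and3P: (partP) => /eqP covP tiP _.
by rewrite eq_pblock ?covP ?inE.
Qed.

Lemma pblock_imset P : partition P [set: T] -> pblock P @: [set: T] = P.
Proof.
move=> partP; case/and3P: (partP) => /eqP covP tiP P0.
apply/setP=> B; apply/imsetP/idP=> [[x _ ->]|PB].
  by rewrite pblock_mem ?covP ?inE.
have [x Bx] : exists x, x \in B.
  by apply/set0Pn; apply: contraNneq P0 => <-.
by exists x; rewrite ?inE // (def_pblock tiP PB Bx).
Qed.

Lemma card_partition_n_comp P e :
    connect_sym e -> partition P [set: T] ->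
    (forall x y, connect e x y = (y \in pblock P x)) ->
  #|P| = n_comp e T.
Proof.
move=> sym_e partP eP; rewrite -{1}(pblock_imset partP).
by apply: card_classes => // x y; rewrite eq_pblockT // eP.
Qed.

Lemma n_comp1 e : (forall x y, connect e x y) -> n_comp e T <= 1.
Proof.
move=> con_e; apply/card_le1_eqP => x y; rewrite !inE !andbT => /eqP rx /eqP ry.
by rewrite -rx -ry; apply/fingraph.rootP; rewrite // => a b; rewrite !con_e.
Qed.

Definition add_edge e (x y : T) : rel T :=
  [rel a b | [|| e a b, (a == x) && (b == y) | (a == y) && (b == x)]].

Lemma add_edge_sym e x y : symmetric e -> symmetric (add_edge e x y).
Proof. by move=> sym_e a b; rewrite /add_edge /= sym_e (andbC (a == x)) (andbC (a == y)) (orbC (_ && _)). Qed.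

(** A path may be shortened so that it crosses the new edge at most once, in one direction or the
    other. *)
Lemma connect_add_edge e x y a b : symmetric e ->
  connect (add_edge e x y) a b ->
  [|| connect e a b, connect e a x && connect e y b
    | connect e a y && connect e x b].
Proof.
move=> sym_e; have csym := sym_connect_sym sym_e.
case/connectP=> p; elim: p a => [|c p IHp] a /= => [_ ->|]; first by rewrite connect0.
case/andP=> eac pc def_b; move: (IHp _ pc def_b).
case/or3P: eac => [eac | /andP[/eqP-> /eqP->] | /andP[/eqP-> /eqP->]].
- have cac := connect1 eac; case/or3P=> [cb|/andP[c1 ->]|/andP[c1 ->]].
  + by rewrite (connect_trans cac cb).
  + by rewrite (connect_trans cac c1) orbT.
  + by rewrite (connect_trans cac c1) !orbT.
- case/or3P=> [cb|/andP[c1 c2]|/andP[c1 c2]].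
  + by rewrite connect0 cb orbT.
  + by rewrite connect0 c2 orbT.
  + by rewrite c2.
- case/or3P=> [cb|/andP[c1 c2]|/andP[c1 c2]].
  + by rewrite connect0 cb !orbT.
  + by rewrite c2.
  + by rewrite connect0 c2 !orbT.
Qed.

Lemma sub_connect_add_edge e x y : subrel (connect e) (connect (add_edge e x y)).
Proof. by apply: connect_sub => a b eab; apply: connect1; rewrite /add_edge /= eab. Qed.

(** One edge merges at most two components: once the old root of [x] is set aside, the remaining old
    roots have pairwise distinct new roots. *)
Lemma n_comp_add_edge e x y : symmetric e ->
  n_comp e T <= n_comp (add_edge e x y) T + 1.
Proof.
move=> sym_e; have csym := sym_connect_sym sym_e.
set e' := add_edge e x y.
have csym' : connect_sym e' by apply/sym_connect_sym/add_edge_sym.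
set A := [set z | roots e z].
have -> : n_comp e T = #|A| by rewrite cardsE; apply: eq_card => z; rewrite !inE andbT.
rewrite (cardsD1 (fingraph.root e x) A) addnC leq_add //; last by case: (_ \in _).
have inj : {in A :\ fingraph.root e x &, injective (fingraph.root e')}.
  move=> a b; rewrite !inE => /andP[ax /eqP ra] /andP[bx /eqP rb] /(fingraph.rootP csym').
  case/(connect_add_edge sym_e)/or3P.
  - by move/(fingraph.rootP csym); rewrite ra rb.
  - by case/andP=> /(fingraph.rootP csym) rax _; rewrite -ra rax eqxx in ax.
  - by case/andP=> _ /(fingraph.rootP csym) rxb; rewrite -rb -rxb eqxx in bx.
rewrite -(card_in_imset inj); apply: subset_leq_card.
by apply/subsetP=> z /imsetP[u _ ->]; rewrite !inE roots_root.
Qed.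

Lemma n_comp_add_edge_connected e x y : symmetric e -> connect e x y ->
  n_comp (add_edge e x y) T = n_comp e T.
Proof.
move=> sym_e cxy; have csym := sym_connect_sym sym_e.
apply: eq_n_comp => a b; apply/idP/idP; last exact: sub_connect_add_edge.
case/(connect_add_edge sym_e)/or3P=> // /andP[c1 c2].
  exact: connect_trans (connect_trans c1 cxy) c2.
by rewrite csym in cxy; apply: connect_trans (connect_trans c1 cxy) c2.
Qed.

Lemma edge_rel_cons u w :
  edge_rel (u :: w) =2 add_edge (edge_rel w) u.1 u.2.
Proof.
case: u => u v x y; rewrite /edge_rel /add_edge /= !inE !xpair_eqE.
by rewrite [in RHS](andbC (x == v)) orbACA orbC.
Qed.

Lemma n_comp_add_edges e E : symmetric e ->
  n_comp e T <= n_comp [rel x y | e x y || edge_rel E x y] T + size E.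
Proof.
elim: E e => [|u E IHE] e sym_e.
  rewrite addn0; apply/eq_leq/eq_n_comp/eq_connect => x y.
  by rewrite /edge_rel /= orbF.
apply: leq_trans (n_comp_add_edge u.1 u.2 sym_e) _.
rewrite addn1 [size _]/= addnS ltnS.
apply: leq_trans (IHE _ (add_edge_sym _ _ sym_e)) _.
rewrite leq_add2r; apply: eq_leq; apply: eq_n_comp; apply: eq_connect => x y.
rewrite /= edge_rel_cons /add_edge /= -orbA; congr (_ || _).
by rewrite orbC.
Qed.

Definition tperms (w : seq (T * T)) : {perm T} := \prod_(u <- w) tperm u.1 u.2.

Lemma tperms_connect w x : connect (edge_rel w) x (tperms w x).
Proof.
have sub u w' : subrel (connect (edge_rel w')) (connect (edge_rel (u :: w'))).
  apply: connect_sub => a b /orP[] ab; apply: connect1; rewrite /edge_rel /=.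
    by rewrite !inE ab orbT.
  by rewrite !inE ab !orbT.
elim: w x => [|u w IHw] x; first by rewrite /tperms big_nil perm1.
rewrite /tperms big_cons permM; apply: connect_trans (sub _ _ _ _ (IHw _)).
case: tpermP => [->|->|_ _]; rewrite ?connect0 //; apply: connect1.
  by rewrite /edge_rel /= -surjective_pairing !inE eqxx.
by rewrite /edge_rel /= -surjective_pairing !inE eqxx orbT.
Qed.

Lemma connect_porbit (s : {perm T}) (e : rel T) : (forall x, connect e x (s x)) ->
  forall x y, y \in porbit s x -> connect e x y.
Proof.
move=> es x y /porbitP[i ->]; elim: i => [|i IHi]; first by rewrite perm1 connect0.
by rewrite expgSr permM; apply: connect_trans IHi (es _).
Qed.

Lemma card_porbits_frel s : #|porbits s| = n_comp (frel s) T.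
Proof.
have -> : porbits s = porbit s @: [set: T].
  by apply/setP=> A; apply/imsetP/imsetP=> -[x _ ->]; exists x.
apply: card_classes => [|x y]; first exact/fconnect_sym/perm_inj.
rewrite eq_porbit_mem porbit_sym; apply/idP/idP.
  by apply: connect_porbit => z; apply: connect1 => /=.
case/connectP=> p; elim: p x => [|z p IHp] x /= => [_ ->|]; first exact: porbit_id.
case/andP=> /eqP <- pz /(IHp _ pz).
by rewrite -[s x]/(aperm x s) -(expg1 s) /aperm !(porbit_perm s 1).
Qed.

(* The Riemann-Hurwitz inequality for a product of transpositions. *)
Lemma leq_porbits_tperms w : all (fun u => u.1 != u.2) w ->
  #|T| + ncycles (tperms w) <= size w + 2 * n_comp (edge_rel w) T.
Proof.
rewrite /ncycles; elim: w => [_|u w IHw] /=.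
  have -> : n_comp (edge_rel [::]) T = #|T|.
    apply: eq_card => x; rewrite !inE andbT; apply/eqP.
    have /connectP[[|y p] //] := connect_root (edge_rel [::]) x.
  rewrite add0n mul2n -addnn leq_add2l /tperms big_nil.
  exact: leq_trans (leq_imset_card _ _) (max_card _).
case/andP=> u12 /IHw{IHw}.
rewrite (eq_n_comp (eq_connect (edge_rel_cons u w))).
rewrite /tperms big_cons -!/(tperms _).
(* A transposition splits a cycle or joins two. If its ends are already connected, the components
   stay and the number of cycles grows by at most one. Otherwise its ends lie in different cycles,
   so the number of cycles drops by one, and the number of components by at most one. *)
have := porbits_mul_tperm (tperms w) u.1 u.2; rewrite /= u12 /=.
have [con|ncon] := boolP (connect (edge_rel w) u.1 u.2).
  rewrite (n_comp_add_edge_connected (edge_rel_sym w) con).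
  by case: (_ \notin _) => /=; lia.
have -> : u.1 \notin porbit (tperms w) u.2.
  apply: contra ncon; rewrite edge_connect_sym.
  exact/connect_porbit/tperms_connect.
have := n_comp_add_edge u.1 u.2 (edge_rel_sym w); rewrite /=; lia.
Qed.

Lemma odd_tperms w : all (fun u => u.1 != u.2) w -> odd_perm (tperms w) = odd (size w).
Proof.
rewrite /tperms; elim: w => [_|u w IHw] /=; first by rewrite big_nil odd_perm1.
by case/andP=> u12 /IHw; rewrite big_cons odd_permM odd_tperm u12 => ->.
Qed.

(** The Riemann-Hurwitz formula: the inequality for a connected graph makes the excess nonnegative,
    and comparing signs makes it even; half of it is the genus. *)
Lemma tperms_genus w : 0 < #|T| -> all (fun u => u.1 != u.2) w ->
    (forall x y, connect (edge_rel w) x y) ->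
  exists g, size w + 2 = #|T| + ncycles (tperms w) + 2 * g.
Proof.
move=> T0 nw con; have := leq_porbits_tperms nw; have := n_comp1 con.
have := odd_tperms nw; rewrite /odd_perm -/(ncycles _) -oddD.
set a := #|T|; set c := ncycles _; set k := n_comp _ _ => eq_odd k1 le1.
have le2 : a + c <= size w + 2 by lia.
exists (size w + 2 - (a + c))./2; rewrite mul2n.
have /even_halfK -> : ~~ odd (size w + 2 - (a + c)).
  by rewrite oddB // eq_odd oddD addbF addbb.
by lia.
Qed.

(* In the bipartite graph on the blocks of P and Q whose edges are the cycles
   of s, connectedness forces at least #|P| + #|Q| - 1 edges. *)
Lemma leq_card_connected_partitions P Q (s : {perm T}) :
    partition P [set: T] -> partition Q [set: T] ->
    (forall x, s x \in pblock P x) -> (forall x, s x \in pblock Q x) ->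
    (forall x y, connect [rel x y | (y \in pblock P x) || (y \in pblock Q x)] x y) ->
  #|P| + #|Q| <= ncycles s + 1.
Proof.
move=> partP partQ sP sQ con.
pose eP := [rel x y | y \in pblock P x]; pose eQ := [rel x y | y \in pblock Q x].
have symP : symmetric eP by move=> x y; rewrite /= -!eq_pblockT // eq_sym.
have symQ : symmetric eQ by move=> x y; rewrite /= -!eq_pblockT // eq_sym.
have conP R : partition R [set: T] ->
    forall x y, connect [rel x y | y \in pblock R x] x y = (y \in pblock R x).
  move=> partR x y; apply/idP/idP=> [|yx]; last exact: connect1.
  case/connectP=> p; elim: p x => [|z p IHp] x /= => [_ ->|].
    by rewrite -eq_pblockT.
  by case/andP; rewrite -eq_pblockT // => /eqP -> pz /(IHp _ pz).
have csymQ := sym_connect_sym symQ.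
have csyms : connect_sym (frel s) by exact/fconnect_sym/perm_inj.
rewrite (card_partition_n_comp (sym_connect_sym symP) partP (conP _ partP)).
pose c := froot s; pose b := fingraph.root eQ.
have cP R x : partition R [set: T] -> (forall x, s x \in pblock R x) -> c x \in pblock R x.
  move=> partR sR; rewrite -conP //.
  apply: connect_sub (connect_root (frel s) x) => u v /eqP <-.
  by apply: connect1; rewrite /= sR.
have bc x : b (c x) = b x.
  by apply/(fingraph.rootP csymQ); rewrite csymQ conP // cP.
(* Within each block of [Q], [E] is a star on the roots of its cycles, centred at the cycle through
   the representative of the block. The centres give no edge, and distinct blocks have distinct
   centres, whence the bound [sizeE]. Adding [E] to the blocks of [P] connects everything. *)
pose E := [seq (x, c (b x)) | x <- enum [set x | (c x == x) && (c (b x) != x)]].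
have sizeE : size E + #|Q| <= ncycles s.
  rewrite size_map -cardE /ncycles card_porbits_frel.
  have -> : n_comp (frel s) T = #|[set x | c x == x]|.
    by rewrite cardsE; apply: eq_card => x; rewrite !inE andbT.
  rewrite -(cardsID [set x | c (b x) != x] [set x | c x == x]).
  have -> : [set x | (c x == x) && (c (b x) != x)] =
     [set x | c x == x] :&: [set x | c (b x) != x] by apply/setP=> x; rewrite !inE.
  rewrite leq_add2l (card_partition_n_comp csymQ partQ (conP _ partQ)).
  have -> : n_comp eQ T = #|[set x | b x == x]|.
    by rewrite cardsE; apply: eq_card => x; rewrite !inE andbT.
  have inj : {in [set x | b x == x] &, injective c}.
    move=> x y; rewrite !inE => /eqP bx /eqP bY cxy.
    by rewrite -bx -bY -bc cxy bc.
  rewrite -(card_in_imset inj); apply: subset_leq_card; apply/subsetP=> _ /imsetP[x + ->].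
  by rewrite !inE => /eqP bx; rewrite bc bx eqxx /= /c root_root ?eqxx.
have le1 := n_comp_add_edges E symP; rewrite -/eP.
set k := n_comp eP T in le1 *.
suff /n_comp1 : forall x y, connect [rel x y | eP x y || edge_rel E x y] x y.
  by move: le1; set k' := n_comp _ _ => le1; move: sizeE; rewrite -/E; lia.
set e := (X in connect X).
have csym : connect_sym e.
  apply: sym_connect_sym => x y; congr (_ || _); first exact: symP.
  exact: edge_rel_sym.
have conc x : connect e x (c x) by apply: connect1; rewrite /e /eP /= cP.
have concb x : connect e x (c (b x)).
  apply: connect_trans (conc x) _.
  have [eq|ne] := eqVneq (c (b x)) (c x); first by rewrite eq connect0.
  apply: connect1; rewrite /e /=; apply/orP; right; apply/orP; left.
  apply/mapP; exists (c x); last by rewrite bc.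
  by rewrite mem_enum inE bc ne /c root_root ?eqxx.
move=> x y; apply: connect_sub (con x y) => u v /= /orP[uv|uv].
  by apply: connect1; rewrite /e /eP /= uv.
apply: connect_trans (concb u) _; rewrite csym.
suff -> : b u = b v by [].
by apply/(fingraph.rootP csymQ); rewrite conP.
Qed.

End Components.

(** * Monotone factorizations are counted by a class function *)

Section MonotoneWords.
Local Open Scope ring_scope.
Variable S : eqType.
Implicit Types (A B : seq S) (As Bs Cs : seq (seq S)) (p w : seq S).

(* Words reading letters from the alphabets of As in weakly increasing order. *)
Fixpoint mwords As : nat -> seq (seq S) :=
  match As with
  | [::] => fun l => if l is 0%N then [:: [::]] else [::]
  | A :: As' =>
    fix aux l := match l with
                 | 0%N => [:: [::]]
                 | l'.+1 => [seq a :: w | a <- A, w <- aux l'] ++ mwords As' l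
                 end
  end.

Lemma mwords0 As : mwords As 0 = [:: [::]].
Proof. by case: As. Qed.

Lemma mwordsS A As l :
  mwords (A :: As) l.+1 =
    [seq a :: w | a <- A, w <- mwords (A :: As) l] ++ mwords As l.+1.
Proof. by []. Qed.

Variable f : seq S -> int.

(** The complete homogeneous sum h_l, evaluated by [f] behind a prefix [p]. The prefix is carried
    along because [f] need not be multiplicative; integer values allow the subtraction in the
    recursion below. *)
Definition wsum As l p : int := \sum_(w <- mwords As l) f (p ++ w).

Lemma wsum0 As p : wsum As 0 p = f p.
Proof. by rewrite /wsum mwords0 big_seq1 cats0. Qed.

Lemma wsumS A As l p :
  wsum (A :: As) l.+1 p =
    \sum_(a <- A) wsum (A :: As) l (rcons p a) + wsum As l.+1 p.
Proof.
rewrite /wsum mwordsS big_cat /= big_allpairs_dep /=; congr (_ + _).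
by apply: eq_bigr => a _; apply: eq_bigr => w _; rewrite cat_rcons.
Qed.

Lemma wsum_congr A B As Bs :
    perm_eq A B -> (forall l p, wsum As l p = wsum Bs l p) ->
  forall l p, wsum (A :: As) l p = wsum (B :: Bs) l p.
Proof.
move=> eqAB eqs; elim=> [|l IHl] p; first by rewrite !wsum0.
rewrite !wsumS eqs; congr (_ + _); rewrite (perm_big _ eqAB) /=.
by apply: eq_bigr => a _; apply: IHl.
Qed.

(* h_{l+2}(A, B, C) = (A + B) h_{l+1}(A, B, C) - B A h_l(A, B, C) + h_{l+2}(C)
   for complete homogeneous sums in noncommuting variables. *)
Lemma wsumSS A B Cs l p :
  wsum [:: A, B & Cs] l.+2 p =
    \sum_(a <- A ++ B) wsum [:: A, B & Cs] l.+1 (rcons p a)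
    - \sum_(b <- B) \sum_(a <- A) wsum [:: A, B & Cs] l (p ++ [:: b; a])
    + wsum Cs l.+2 p.
Proof.
rewrite [LHS]wsumS big_cat /= -!addrA; congr (_ + _).
(* Expand h_{l+2}(B, C) as B h_{l+1}(B, C) + h_{l+2}(C), and then use h_{l+1}(B, C) = h_{l+1}(A, B,
   C) - A h_l(A, B, C). *)
rewrite wsumS addrA; congr (_ + _); rewrite -sumrB; apply: eq_bigr => b _.
rewrite [X in _ = X - _]wsumS addrAC.
rewrite [X in _ - X](_ : _ = \sum_(a <- A) wsum [:: A, B & Cs] l (rcons (rcons p b) a)).
  by rewrite subrr add0r.
by apply: eq_bigr => a _; rewrite -!cats1 -catA.
Qed.

(** The recursion [wsumSS] sees the first two alphabets only through A + B and BA, so replacing them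
    by alphabets with the same sum and product is harmless. *)
Lemma wsum_swap A B A' B' Cs :
    perm_eq (A ++ B) (A' ++ B') ->
    (forall l p, \sum_(b <- B) \sum_(a <- A) wsum [:: A, B & Cs] l (p ++ [:: b; a])
     = \sum_(b <- B') \sum_(a <- A') wsum [:: A, B & Cs] l (p ++ [:: b; a])) ->
  forall l p, wsum [:: A, B & Cs] l p = wsum [:: A', B' & Cs] l p.
Proof.
move=> eqAB swap l p.
(* The recursion has order two, so two consecutive lengths are carried through the induction. *)
suff [] : (forall p, wsum [:: A, B & Cs] l p = wsum [:: A', B' & Cs] l p)
  /\ (forall p, wsum [:: A, B & Cs] l.+1 p = wsum [:: A', B' & Cs] l.+1 p) by [].
elim: l {p} => [|l [IH0 IH1]]; split=> // p.
  rewrite !wsumS !addrA; congr (_ + _).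
  have sum0 X As : \sum_(a <- X) wsum As 0 (rcons p a) = \sum_(a <- X) f (rcons p a).
    by apply: eq_bigr => a _; rewrite wsum0.
  by rewrite !sum0 -!big_cat /= (perm_big _ eqAB).
rewrite !wsumSS (perm_big _ eqAB) /= swap; congr (_ - _ + _).
  by apply: eq_bigr => a _; apply: IH1.
by apply: eq_bigr => b _; apply: eq_bigr => a _; apply: IH0.
Qed.

End MonotoneWords.

Lemma mwords_map (S S' : eqType) (h : S -> S') As l :
  mwords (map (map h) As) l = map (map h) (mwords As l).
Proof.
elim: As l => [|A As IHAs] l; first by case: l.
elim: l => [|l IHl] //; rewrite [map (map h) (A :: As)]/= !mwordsS map_cat IHAs.
congr (_ ++ _); rewrite -/(map _ (A :: As)) {}IHl map_allpairs.
by rewrite allpairs_mapl allpairs_mapr.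
Qed.

(** * Monotone sequences as words in Jucys-Murphy alphabets *)

Section MonotoneTranspositions.
Variable n : nat.
Implicit Types (js : seq 'I_n) (w : seq ('I_n * 'I_n)).

Definition below (j : 'I_n) : seq 'I_n := [seq i : 'I_n <- enum 'I_n | i < j].

Lemma mem_below j i : (i \in below j) = (i < j).
Proof. by rewrite mem_filter mem_enum andbT. Qed.

Lemma below_uniq j : uniq (below j).
Proof. by rewrite filter_uniq ?enum_uniq. Qed.

(** The terms of the Jucys-Murphy element X_j. *)
Definition transp_alphabet (j : 'I_n) : seq ('I_n * 'I_n) :=
  [seq (i, j) | i <- below j].

Lemma mem_transp_alphabet j u :
  (u \in transp_alphabet j) = (u.1 < u.2) && (u.2 == j).
Proof.
case: u => i j'; apply/mapP/andP=> /= [[i' + [-> ->]]|[ij /eqP<-]].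
  by rewrite mem_below eqxx.
by exists i; rewrite ?mem_below.
Qed.

Lemma monotone_transps_cons u w :
  monotone_transps (u :: w) =
    [&& u.1 < u.2, all (fun v : 'I_n * 'I_n => u.2 <= v.2) w & monotone_transps w].
Proof.
rewrite /monotone_transps [sorted _ (u :: w)]/= path_sortedE; last first.
  by move=> v1 v2 v3; apply: leq_trans.
by rewrite /= -!andbA; congr (_ && _); rewrite andbCA.
Qed.

(** The alphabet of a letter is its maximum, so reading alphabets in order means having weakly
    monotone maxima. *)
Lemma mem_mwords_transp js l w : sorted (fun i j : 'I_n => i < j) js ->
  (w \in mwords (map transp_alphabet js) l) =
    [&& size w == l, monotone_transps w & all (fun u => u.2 \in js) w].
Proof.
elim: js l w => [|j js IHjs] l w srt.
  case: w => [|u w]; first by case: l.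
  by case: l => [|l]; rewrite /= ?andbF.
have lt_j i : i \in js -> j < i.
  move: srt; rewrite /= path_sortedE => [/andP[/allP jjs _]|]; first exact: jjs.
  by move=> a b c; apply: ltn_trans.
have {}IHjs := IHjs _ _ (path_sorted srt).
elim: l w => [|l IHl] w; first by case: w.
rewrite [map _ _]/= mwordsS mem_cat IHjs -/(map _ (j :: js)).
case: w => [|u w].
  by rewrite /= orbF; apply/negbTE/allpairsP => -[[? ?] []].
have -> : (u :: w \in [seq a :: w | a <- transp_alphabet j,
             w <- mwords (map transp_alphabet (j :: js)) l]) =
          (u \in transp_alphabet j) && (w \in mwords (map transp_alphabet (j :: js)) l).
  apply/allpairsP/andP=> [[[a w'] /= [ha hw [-> ->]]] //|[hu hw]].
  by exists (u, w).
rewrite IHl mem_transp_alphabet !monotone_transps_cons /= eqSS.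
case sz : (size w == l) => //=; last by rewrite andbF.
rewrite -[u.2 \in j :: js]/((u.2 == j) || (u.2 \in js)).
case: (u.1 < u.2) => //=.
have [eq_j|ne_j] /= := eqVneq u.2 j.
  have -> : (u.2 \in js) = false.
    by apply/negP=> /lt_j; rewrite eq_j ltnn.
  rewrite andbF orbF eq_j.
  case mon: (monotone_transps w) => /=; last by rewrite andbF.
  rewrite andbT andb_idl // => /allP alw; apply/allP=> v /alw.
  by rewrite inE => /predU1P[->//|/lt_j/ltnW].
case ujs: (u.2 \in js) => /=; last by rewrite andbF.
case le_u: (all _ w) => //=.
case mon: (monotone_transps w) => //=.
apply: eq_in_all => v /(allP le_u) uv; rewrite inE.
case: eqVneq => //= vj; move: (lt_j _ ujs); rewrite -vj ltnNge uv //.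
Qed.

Lemma mwords_transp_uniq js l : sorted (fun i j : 'I_n => i < j) js ->
  uniq (mwords (map transp_alphabet js) l).
Proof.
elim: js l => [|j js IHjs] l srt; first by case: l.
elim: l => [|l IHl] //.
rewrite [map _ _]/= mwordsS cat_uniq -/(map _ (j :: js)) IHjs ?(path_sorted srt) //.
rewrite andbT; apply/andP; split.
  apply: allpairs_uniq => //.
    by rewrite map_inj_uniq ?below_uniq // => i i' [].
  by move=> [a w] [a' w'] _ _ /= [-> ->].
apply/hasPn=> w; rewrite mem_mwords_transp ?(path_sorted srt) //.
case/and3P=> _ _ alw; apply/allpairsP=> -[[a w'] /= [ha _ def_w]].
move: alw; rewrite def_w /= => /andP[+ _].
move: ha; rewrite mem_transp_alphabet => /andP[_ /eqP->].
move: srt; rewrite /= path_sortedE => [/andP[/allP jjs _] /jjs|].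
  by rewrite ltnn.
by move=> x y z; apply: ltn_trans.
Qed.

Lemma enum_ord_sorted : sorted (fun i j : 'I_n => i < j) (enum 'I_n).
Proof.
by have := iota_ltn_sorted 0 n; rewrite -val_enum_ord sorted_map.
Qed.

Lemma card_monotone_transps (Q : pred (seq ('I_n * 'I_n))) l :
  #|[set mu : l.-tuple ('I_n * 'I_n) | monotone_transps mu && Q mu]| =
    \sum_(w <- mwords (map transp_alphabet (enum 'I_n)) l) Q w.
Proof.
set W := mwords _ _; rewrite -big_mkcond /= sum1_count -size_filter.
have Wuniq : uniq W by exact/mwords_transp_uniq/enum_ord_sorted.
have memW w : (w \in W) = (size w == l) && monotone_transps w.
  rewrite mem_mwords_transp ?enum_ord_sorted //; congr (_ && _).
  by rewrite (@eq_all _ _ predT) ?all_predT ?andbT // => u; rewrite /= mem_enum.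
rewrite cardE -(size_map val); apply: perm_size; apply: uniq_perm.
- by rewrite map_inj_uniq ?enum_uniq //; apply: val_inj.
- exact: filter_uniq.
move=> w; rewrite mem_filter memW; apply/mapP/andP=> [[mu + ->]|[Qw /andP[sz mon]]].
  by rewrite mem_enum inE => /andP[-> ->]; rewrite size_tuple eqxx.
by exists (Tuple sz); rewrite // mem_enum inE /= mon.
Qed.

End MonotoneTranspositions.

(** * Invariance under conjugation by adjacent transpositions *)

Section ConjugationInvariance.
Variable n : nat.
Implicit Types (k : 'I_n) (p q w : seq 'S_n).
Local Open Scope group_scope.

(** Invariance under Hurwitz moves, which preserve the product since s t = t (s ^ t). *)
Definition braid_invariant (f : seq 'S_n -> int) :=
  forall p (s t : 'S_n) q, f (p ++ [:: s, t & q]) = f (p ++ [:: t, s ^ t & q]).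

Definition transp_letters (g : 'S_n -> 'S_n) (j : 'I_n) : seq 'S_n :=
  [seq g (transp u) | u <- transp_alphabet j].

Lemma transp_letters_conj (u : 'S_n) j :
  transp_letters (conjg^~ u) j = [seq tperm (u i) (u j) | i <- below j].
Proof.
by rewrite /transp_letters /transp_alphabet -map_comp; apply: eq_map => i /=; rewrite tpermJ.
Qed.

Lemma transp_letters_id j :
  transp_letters id j = [seq tperm i j | i <- below j].
Proof. by rewrite /transp_letters /transp_alphabet -map_comp. Qed.

(** For [k'] = [k] + 1 and [ks] the points below [k], this says that X_(k+1) X_k equals its
    conjugate by (k k+1). After pairing by [i], the terms (i k') (j k) with j distinct from i
    commute, and the two remaining terms are exchanged by braid moves. *)
Lemma big_braid_swap (G : 'S_n -> 'S_n -> int) (k k' : 'I_n) (ks : seq 'I_n) :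
    (forall s t, G s t = G t (s ^ t)) -> uniq ks -> k \notin ks -> k' \notin ks -> k != k' ->
  (\sum_(s <- tperm k k' :: [seq tperm i k' | i <- ks])
     \sum_(t <- [seq tperm i k | i <- ks]) G s t =
   \sum_(s <- tperm k k' :: [seq tperm i k | i <- ks])
     \sum_(t <- [seq tperm i k' | i <- ks]) G s t)%R.
Proof.
move=> braid uks kks k'ks kk'; rewrite !big_cons !big_map.
under [X in (_ + X = _)%R]eq_bigr do rewrite big_map.
under [X in (_ = _ + X)%R]eq_bigr do rewrite big_map.
rewrite [X in (_ = _ + X)%R]exchange_big -!big_split /=.
apply: eq_big_seq => i iks.
have ne j : j \in ks -> (j != k) && (j != k').
  by move=> jks; apply/andP; split; [apply: contraNneq kks | apply: contraNneq k'ks] => <-.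
have /andP[ik ik'] := ne i iks.
rewrite !(bigD1_seq i) //= !addrA; congr (_ + _)%R; last first.
  rewrite big_seq_cond [RHS]big_seq_cond; apply: eq_bigr => j /andP[jks ji].
  have /andP[jk jk'] := ne j jks.
  by rewrite braid tpermJ !tpermD // 1?eq_sym.
rewrite [G (tperm k k') (tperm i k)]braid [G (tperm k k') (tperm i k')]braid.
have -> : tperm k k' ^ tperm i k = tperm i k'.
  by rewrite tpermJ tpermR (tpermD ik') // eq_sym.
have -> : tperm k k' ^ tperm i k' = tperm i k.
  by rewrite tpermJ tpermR (tpermD ik) 1?eq_sym // tpermC.
exact: addrC.
Qed.

(** Only the two adjacent alphabets at [k] and [k'] change under the conjugation, and [wsum_swap]
    treats them together. *)
Lemma wsum_conj_adjacent (f : seq 'S_n -> int) (k k' : 'I_n) l p :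
    braid_invariant f -> k' = k.+1 :> nat ->
  wsum f (map (transp_letters id) (enum 'I_n)) l p =
  wsum f (map (transp_letters (conjg^~ (tperm k k'))) (enum 'I_n)) l p.
Proof.
move=> braid k'E; set u := tperm k k'.
have kk' : k != k' by apply/eqP=> kk; move: k'E; rewrite -kk; lia.
have splitE : enum 'I_n = take k (enum 'I_n) ++ [:: k, k' & drop k.+2 (enum 'I_n)].
  rewrite -{1}(cat_take_drop k (enum 'I_n)) (drop_nth k) ?size_enum_ord //.
  rewrite nth_ord_enum (drop_nth k) -k'E ?size_enum_ord //.
  by rewrite nth_ord_enum.
have := enum_uniq 'I_n; rewrite splitE.
set pre := take _ _; set post := drop _ _ => uniqE.
have notkk j : j \in pre \/ j \in post -> (j != k) /\ (j != k').
  move: uniqE; rewrite cat_uniq /= !inE !negb_or => /and3P[_ /and3P[kpre k'pre prepost]].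
  case/and3P=> /andP[_ kpost] k'post _ [jp|jp]; split.
  - by apply: contraNneq kpre => <-.
  - by apply: contraNneq k'pre => <-.
  - by apply: contraNneq kpost => <-.
  - by apply: contraNneq k'post => <-.
(* For other [j], the points [k] and [k'] are both below [j] or both above it, so conjugation merely
   permutes the letters of X_j. *)
have eq_other js : (forall j, j \in js -> (j != k) /\ (j != k')) -> forall As Bs,
     (forall l p, wsum f As l p = wsum f Bs l p) -> forall l p,
   wsum f (map (transp_letters id) js ++ As) l p =
   wsum f (map (transp_letters (conjg^~ u)) js ++ Bs) l p.
  elim: js => [|j js IHjs] //= njs As Bs eqAB; apply: wsum_congr; last first.
    by apply: IHjs => // i ijs; apply: njs; rewrite inE ijs orbT.
  rewrite transp_letters_id transp_letters_conj.
  have [jk jk'] := njs j (mem_head _ _).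
  have -> : u j = j by rewrite tpermD // eq_sym.
  rewrite (map_comp (tperm^~ j) u); apply: perm_map; apply: uniq_perm.
  - exact: below_uniq.
  - by rewrite map_inj_uniq ?below_uniq //; apply: perm_inj.
  move=> i; rewrite mem_below -{2}(tpermK k k' i) mem_map ?mem_below; last exact: perm_inj.
  by move: jk jk'; rewrite -!val_eqE /= k'E; case: tpermP => [->|->|//]; rewrite ?k'E; lia.
rewrite !map_cat; apply: (eq_other) => [j jp|{l p} l p]; first by apply: notkk; left.
rewrite [map (transp_letters id) _]/= [map (transp_letters (conjg^~ u)) _]/=.
(* X_k is the sum of [a], and X_k' is that of [b] plus the letter [tperm k k']; conjugation
   exchanges [a] with [b] and fixes that letter. *)
pose a := [seq tperm i k | i <- below k]; pose b := [seq tperm i k' | i <- below k].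
have kb : k \notin below k by rewrite mem_below ltnn.
have k'b : k' \notin below k by rewrite mem_below k'E ltnNge leqnSn.
have below' : perm_eq (below k') (k :: below k).
  apply: uniq_perm; rewrite /= ?below_uniq ?kb // => i.
  by rewrite inE !mem_below k'E ltnS leq_eqVlt.
have ubelow i : i \in below k -> u i = i.
  move=> ib; apply: tpermD; first by apply: contraTneq ib => <-.
  by apply: contraTneq ib => <-.
have wid : wsum f [:: transp_letters id k, transp_letters id k'
                    & map (transp_letters id) post] l p =
           wsum f [:: a, tperm k k' :: b & map (transp_letters id) post] l p.
  apply: wsum_congr => [|l1 p1]; first by rewrite transp_letters_id.
  apply: wsum_congr => //; rewrite transp_letters_id.
  by rewrite -/(map _ (k :: below k)) perm_map.
have wconj : wsum f [:: transp_letters (conjg^~ u) k, transp_letters (conjg^~ u) k'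
                    & map (transp_letters (conjg^~ u)) post] l p =
           wsum f [:: b, tperm k k' :: a & map (transp_letters id) post] l p.
  apply: wsum_congr => [|l1 p1].
    rewrite transp_letters_conj tpermL (_ : map _ _ = b) //.
    by apply/eq_in_map => i /ubelow ->.
  apply: wsum_congr => [|l2 p2].
    rewrite transp_letters_conj tpermR (perm_trans (perm_map _ below')) //=.
    rewrite tpermL (tpermC k' k) perm_cons (_ : map _ _ = a) //.
    by apply/eq_in_map => i /ubelow ->.
  rewrite -[map (transp_letters id) _]cats0 -[map (transp_letters (conjg^~ u)) _]cats0.
  by symmetry; apply: eq_other => // j jp; apply: notkk; right.
rewrite wid wconj; apply: wsum_swap => [|l1 p1].
  apply/seq.permP=> P; rewrite !count_cat /=.
  by rewrite addnC -addnA [RHS]addnCA.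
pose G s t := wsum f [:: a, tperm k k' :: b & map (transp_letters id) post] l1 (p1 ++ [:: s; t]).
apply: (@big_braid_swap G) => //; last exact: below_uniq.
by move=> s t; rewrite /G /wsum; apply: eq_bigr => w _; rewrite -!catA /= braid.
Qed.

End ConjugationInvariance.

(** * Transitive monotone factorizations as a class function *)

Section ClassFunction.
Variable n : nat.
Implicit Types (nu u s t : 'S_n) (w : seq 'S_n).
Local Open Scope group_scope.

Definition letter_set w : {set 'S_n} := [set x in w].

Definition transitive_factorization nu w : int :=
  Posz ((\prod_(x <- w) x == nu) && [transitive <<letter_set w>>, on [set: 'I_n] | 'P]).

Lemma gen_seqP (G : {group 'S_n}) w :
  reflect (forall x, x \in w -> x \in G) (<<letter_set w>> \subset G).
Proof.
rewrite gen_subG; apply: (iffP subsetP) => sub x.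
  by move=> xw; apply: sub; rewrite inE.
by rewrite inE => /sub.
Qed.

(** A Hurwitz move keeps the product, and each of the two words has its letters in the group
    generated by the other. *)
Lemma braid_transitive_factorization nu : braid_invariant (transitive_factorization nu).
Proof.
move=> p s t q; rewrite /transitive_factorization.
have -> : \prod_(x <- p ++ [:: s, t & q]) x = \prod_(x <- p ++ [:: t, s ^ t & q]) x.
  by rewrite !big_cat !big_cons /=; congr (_ * _); rewrite mulgA (conjgC s t) -mulgA.
suff -> : <<letter_set (p ++ [:: s, t & q])>> = <<letter_set (p ++ [:: t, s ^ t & q])>> by [].
apply/eqP; rewrite eqEsubset; apply/andP; split; apply/gen_seqP=> x;
  rewrite mem_cat !inE.
- have tG : t \in <<letter_set (p ++ [:: t, s ^ t & q])>>.
    by rewrite mem_gen // inE mem_cat !inE eqxx orbT.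
  case/or4P=> [xp|/eqP->|/eqP->|xq] //; try by rewrite mem_gen // inE mem_cat !inE ?xp ?xq ?orbT.
  by rewrite -(groupJr _ tG) mem_gen // inE mem_cat !inE eqxx !orbT.
- have tG : t \in <<letter_set (p ++ [:: s, t & q])>>.
    by rewrite mem_gen // inE mem_cat !inE eqxx !orbT.
  case/or4P=> [xp|/eqP->|/eqP->|xq] //; try by rewrite mem_gen // inE mem_cat !inE ?xp ?xq ?orbT.
  by rewrite groupJr // mem_gen // inE mem_cat !inE eqxx !orbT.
Qed.

(** The generator [nu] is redundant in the definition of [p_C], being the product of the letters. *)
Lemma p_C1E nu l :
  ((p_C nu 1 l)%:Z =
     wsum (transitive_factorization nu) (map (transp_letters id) (enum 'I_n)) l [::])%R.
Proof.
pose Q (mu : seq ('I_n * 'I_n)) := (\prod_(x <- map (@transp n) mu) x == nu) &&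
   [transitive <<letter_set (map (@transp n) mu)>>, on [set: 'I_n] | 'P].
rewrite /p_C (_ : [set _ | _] = [set mu : l.-tuple ('I_n * 'I_n) | monotone_transps mu && Q mu]).
  rewrite card_monotone_transps /wsum.
  have -> : map (transp_letters id) (enum 'I_n) =
             map (map (@transp n)) (map (@transp_alphabet n) (enum 'I_n)).
    by rewrite -map_comp.
  by rewrite mwords_map big_map -natz natr_sum; apply: eq_bigr => w _; rewrite natz.
apply/setP=> mu; rewrite !inE; congr (_ && _); rewrite /Q big_map mulg1 eq_sym.
case: eqP => //= prod_mu.
suff -> : <<[set nu; 1] :|: [set transp u | u in mu]>> = <<letter_set (map (@transp n) mu)>> by [].
have -> : [set transp u | u in mu] = letter_set (map (@transp n) mu).
  by apply/setP=> x; rewrite inE; apply/imsetP/mapP => -[u umu ->]; exists u.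
apply/eqP; rewrite eqEsubset !gen_subG; apply/andP; split; apply/subsetP=> x.
  rewrite !inE => /orP[/orP[]/eqP->|xmu]; last by rewrite mem_gen // inE.
    rewrite -prod_mu big_seq; apply: group_prod => u umu.
    by rewrite mem_gen // inE map_f.
  exact: group1.
by rewrite !inE => xmu; rewrite mem_gen // !inE xmu orbT.
Qed.

Lemma transitiveJ (A : {set 'S_n}) u :
  [transitive <<A :^ u>>, on [set: 'I_n] | 'P] = [transitive <<A>>, on [set: 'I_n] | 'P].
Proof.
suff imp B v : [transitive <<B>>, on [set: 'I_n] | 'P] ->
               [transitive <<B :^ v>>, on [set: 'I_n] | 'P].
  by apply/idP/idP=> /imp; [move/(_ u^-1); rewrite conjsgK | apply].
case/imsetP=> x _ orbx; apply/imsetP; exists (v x) => //.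
apply/setP=> y; rewrite inE; symmetry; apply/orbitP.
have /orbitP[g gB gx] : v^-1 y \in orbit 'P <<B>> x by rewrite -orbx.
exists (g ^ v); first by rewrite genJ memJ_conjg.
by rewrite /= apermE permJ -[g x]/(aperm x g) /= -[aperm x g]/('P%act x g) gx permKV.
Qed.

(** Factorizations of the conjugate may be counted over conjugated alphabets; undoing the
    conjugation letter by letter gives factorizations of [nu]. *)
Lemma p_C1_conj_adjacent nu l (k k' : 'I_n) : k' = k.+1 :> nat ->
  p_C (nu ^ tperm k k') 1 l = p_C nu 1 l.
Proof.
move=> k'E; apply/eqP; rewrite -eqz_nat !p_C1E.
rewrite (wsum_conj_adjacent _ _ (braid_transitive_factorization _) k'E).
set u := tperm k k'; apply/eqP; rewrite /wsum.
have -> : map (transp_letters (conjg^~ u)) (enum 'I_n) =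
          map (map (conjg^~ u)) (map (transp_letters id) (enum 'I_n)).
  rewrite -[RHS]map_comp; apply: eq_map => j; rewrite /= /transp_letters.
  by elim: transp_alphabet => //= v vs ->.
rewrite mwords_map big_map; apply: eq_bigr => w _; rewrite /transitive_factorization.
have -> : \prod_(x <- map (conjg^~ u) w) x = (\prod_(x <- w) x) ^ u.
  elim: w => [|x w IHw]; first by rewrite !big_nil conj1g.
  by rewrite /= !big_cons IHw conjMg.
rewrite (inj_eq (conjg_inj u)).
have -> : letter_set (map (conjg^~ u) w) = (letter_set w) :^ u.
  apply/setP=> x; rewrite inE mem_conjg inE -{1}(conjgKV u x).
  exact: (mem_map (@conjg_inj _ u)).
by rewrite transitiveJ.
Qed.

Lemma p_C1_conj nu u l : p_C (nu ^ u) 1 l = p_C nu 1 l.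
Proof.
(* Induction on the distance: (i j) = (m j) (i m) (m j) with m = j - 1. *)
have tp_lt d (i j : 'I_n) : j = i + d.+1 :> nat -> forall nu', p_C (nu' ^ tperm i j) 1 l = p_C nu' 1 l.
  elim: d j => [|d IHd] j jE nu'.
    by apply: p_C1_conj_adjacent; rewrite jE addn1.
  have lt_m : i + d.+1 < n by apply: leq_trans (ltn_ord j); rewrite jE !addnS.
  pose m := Ordinal lt_m.
  have mE : m = i + d.+1 :> nat by [].
  have jm : j = m.+1 :> nat by rewrite jE mE addnS.
  have -> : tperm i j = tperm m j * tperm i m * tperm m j.
    rewrite -[in LHS](tpermL m j) -{1}(@tpermD _ m j i) -?tpermJ.
    - by rewrite conjgE tpermV mulgA.
    - by apply/eqP=> /(congr1 val) /=; lia.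
    - by apply/eqP=> /(congr1 val) /=; rewrite jE; lia.
  by rewrite !conjgM !(p_C1_conj_adjacent _ _ jm) IHd // (p_C1_conj_adjacent _ _ jm).
have tp (i j : 'I_n) nu' : p_C (nu' ^ tperm i j) 1 l = p_C nu' 1 l.
  case: (ltngtP i j) => [ij|ji|/val_inj->].
  - by apply: (tp_lt (j - i.+1)); lia.
  - by rewrite tpermC; apply: (tp_lt (i - j.+1)); lia.
  - by rewrite tperm1 conjg1.
have [ts -> _] := prod_tpermP u; elim: ts nu => [|[i j] ts IHts] nu.
  by rewrite big_nil conjg1.
by rewrite big_cons conjgM IHts tp.
Qed.

End ClassFunction.

(** * Permutations of equal cycle type are conjugate *)

Section CycleType.
Variable T : finType.
Implicit Types (s t u : {perm T}).
Local Open Scope group_scope.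

Lemma geq_total : total geq. Proof. by move=> x y; apply: leq_total. Qed.
Lemma geq_trans : transitive geq. Proof. by move=> x y z xy yz; apply: leq_trans xy. Qed.
Lemma geq_anti : antisymmetric geq. Proof. by move=> x y /anti_leq. Qed.

Lemma size_cycle_type s : size (cycle_type s) = ncycles s.
Proof. by rewrite size_sort size_map -cardE. Qed.

Lemma expg_porbit_eq s x i j :
  ((s ^+ i) x == (s ^+ j) x) = (i == j %[mod #|porbit s x|]).
Proof.
set m := #|_|; have m0 : 0 < m by rewrite lt0n card_porbit_neq0.
have modE k : (s ^+ k) x = nth x (traject s x m) (k %% m).
  rewrite nth_traject ?ltn_mod //.
  rewrite [in LHS](divn_eq k m) addnC expgD permM.
  have -> : iter (k %% m) s x = (s ^+ (k %% m)) x by rewrite permX.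
  rewrite -!permM -expgD addnC expgD permM; congr ((s ^+ _) _).
  rewrite mulnC expgM permX; elim: (k %/ m) => //= q ->.
  by rewrite permX iter_porbit.
rewrite !modE nth_uniq ?size_traject ?ltn_mod ?uniq_traject_porbit //.
Qed.

(** Serves to list the cycles of two permutations side by side with matching lengths. *)
Lemma perm_eq_map_ex (S : eqType) (S' : eqType) (h : S -> S') (r r' : seq S) :
  perm_eq (map h r) (map h r') -> exists2 r'', perm_eq r'' r' & map h r = map h r''.
Proof.
case: r' => [|x0 r'].
  by move/perm_nilP/(congr1 size); case: r => // _; exists [::].
move=> /(perm_iotaP (h x0))[Is pIs ->]; exists (map (nth x0 (x0 :: r')) Is).
  apply: (@perm_trans _ (mkseq (nth x0 (x0 :: r')) (size (x0 :: r')))).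
    by rewrite perm_map //; move: pIs; rewrite size_map.
  by rewrite mkseq_nth.
rewrite -map_comp; apply/eq_in_map => i; rewrite (perm_mem pIs) mem_iota /= size_map => ltr.
by rewrite -(nth_map x0 (h x0)).
Qed.

Lemma cycle_type_conj s t : cycle_type s = cycle_type t -> exists u, s ^ u = t.
Proof.
move/(perm_sortP geq_total geq_trans geq_anti)/perm_eq_map_ex => [r pr eq_card].
pose A := enum (porbits s).
have sizeA : size A = size r by have := congr1 size eq_card; rewrite !size_map.
(* [r] lists the cycles of [t] in an order whose lengths agree with those of [A], so [phi] matches
   each cycle of [s] with one of [t] of the same length. *)
pose phi C := nth set0 r (index C A).
have porbA x : porbit s x \in A by rewrite mem_enum imset_f.
have phi_porb x : exists y, phi (porbit s x) = porbit t y.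
  have /imsetP[y _ ->] : phi (porbit s x) \in porbits t.
    by rewrite -mem_enum -(perm_mem pr) mem_nth // -sizeA index_mem.
  by exists y.
have phi_card x : #|phi (porbit s x)| = #|porbit s x|.
  have lt : index (porbit s x) A < size A by rewrite index_mem.
  rewrite -[in RHS](nth_index set0 (porbA x)).
  rewrite -[RHS](nth_map set0 0 (fun C : {set T} => #|C|)) // eq_card.
  by rewrite (nth_map set0) // -sizeA.
have phi_inj x y : phi (porbit s x) = phi (porbit s y) -> porbit s x = porbit s y.
  move/eqP; rewrite nth_uniq -?sizeA ?index_mem ?(perm_uniq pr) ?enum_uniq //.
  by move/eqP/(congr1 (nth set0 A)); rewrite !nth_index.
(* A base point of [C]. The default [x] is never taken on a cycle, which is nonempty; hence
   [rep_eq]. *)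
pose rep (C : {set T}) x := odflt x [pick y in C].
have repP s' x : exists i, x = (s' ^+ i) (rep (porbit s' x) x).
  rewrite /rep; case: pickP => [y /= |/(_ x)]; last by rewrite porbit_id.
  by rewrite porbit_sym => /porbitP[i ->]; exists i.
have rep_porb s' x : porbit s' (rep (porbit s' x) x) = porbit s' x.
  by have [i {3}->] := repP s' x; rewrite porbit_perm.
have rep_eq s' x y : porbit s' x = porbit s' y -> rep (porbit s' x) x = rep (porbit s' y) y.
  move=> exy; rewrite /rep exy; case: pickP => //= /(_ y).
  by rewrite porbit_id.
pose r0 x := rep (porbit s x) x.
pose r1 x := rep (phi (porbit s x)) x.
have r1_porb x : porbit t (r1 x) = phi (porbit s x).
  have [y phiy] := phi_porb x; rewrite /r1 /rep phiy.
  case: pickP => [z /= zy|/(_ y)]; last by rewrite porbit_id.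
  by apply/eqP; rewrite eq_porbit_mem.
have r1_eq x y : porbit s x = porbit s y -> r1 x = r1 y.
  move=> exy; rewrite /r1 /rep exy; case: pickP => //=.
  by have [z ->] := phi_porb y => /(_ z); rewrite porbit_id.
have ex_i x : {i | x == (s ^+ i) (r0 x)}.
  by apply/sigW; have [i {1}->] := repP s x; exists i.
(* f sends s^i r0 to t^i r1, where r0 and r1 are the chosen points of a cycle
   of s and of the cycle of t matched with it by phi. *)
pose f x := (t ^+ sval (ex_i x)) (r1 x).
have fE x i : x = (s ^+ i) (r0 x) -> f x = (t ^+ i) (r1 x).
  move=> xi; apply/eqP; rewrite expg_porbit_eq r1_porb phi_card -(rep_porb s x).
  by rewrite -expg_porbit_eq -/(r0 x) -xi eq_sym; apply: (svalP (ex_i x)).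
have f_s x : f (s x) = t (f x).
  have sx_x : porbit s (s x) = porbit s x by rewrite -(porbit_perm s 1 x) expg1.
  have [i xi] := repP s x.
  rewrite (fE x i xi) (fE (s x) i.+1).
    by rewrite expgSr permM (r1_eq _ _ sx_x).
  by rewrite /r0 (rep_eq _ _ _ sx_x) expgSr permM -xi.
have f_inj : injective f.
  move=> x y fxy.
  have xy : porbit s x = porbit s y.
    apply: phi_inj; rewrite -!r1_porb.
    have pf z : porbit t (f z) = porbit t (r1 z) by rewrite /f porbit_perm.
    by rewrite -!pf fxy.
  have [i xi] := repP s x; have [j yj] := repP s y.
  rewrite xi yj (rep_eq _ _ _ xy); apply/eqP.
  rewrite expg_porbit_eq rep_porb -phi_card -r1_porb -expg_porbit_eq.
  by rewrite -(fE y j yj) -(r1_eq _ _ xy) -(fE x i xi) fxy.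
exists (perm f_inj); apply/permP=> y; rewrite -(permKV (perm f_inj) y).
by rewrite permJ !permE f_s.
Qed.

End CycleType.

(** All terms of the single Hurwitz number are equal, so dividing by the size of the class leaves
    the count for one permutation. *)
Lemma single_hurwitz_class m (nu : 'S_m) h c : cycle_type nu = c ->
  ((single_hurwitz m h c)%:R / #|perm_class m c|%:R = (p_C nu 1%g (size c + m + 2 * h - 2))%:R :> rat)%R.
Proof.
move=> nuc; rewrite /single_hurwitz.
rewrite (eq_bigr (fun=> p_C nu 1%g (size c + m + 2 * h - 2))); last first.
  move=> s; rewrite inE => /eqP sc.
  by have [u <-] := cycle_type_conj (etrans nuc (esym sc)); rewrite p_C1_conj.
rewrite sum_nat_const natrM mulrC mulKf // pnatr_eq0 -lt0n.
by apply/card_gt0P; exists nu; rewrite inE nuc.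
Qed.

(** * Orbit partitions and their blocks *)

Section GeneratedOrbits.
Local Open Scope group_scope.
Variable T : finType.
Implicit Types (A : {set {perm T}}) (e : rel T) (P : {set {set T}}) (s t : {perm T}).

(** The permutations that move every point within its component form a group, which contains the
    generators. *)
Lemma orbit_gen_connect A e x y :
    (forall s, s \in A -> forall z, connect e z (s z)) ->
  y \in orbit 'P <<A>> x -> connect e x y.
Proof.
move=> eA /orbitP[g gA <-]; rewrite /= apermE.
pose H := [set h : {perm T} | [forall z, connect e z (h z)]].
have gH : group_set H.
  apply/group_setP; split=> [|h k].
    by rewrite inE; apply/forallP=> z; rewrite perm1 connect0.
  rewrite !inE => /forallP hH /forallP kH; apply/forallP=> z.
  by rewrite permM; apply: connect_trans (hH z) (kH _).
have /subsetP/(_ _ gA) : <<A>> \subset Group gH.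
  by rewrite gen_subG; apply/subsetP=> s sA; rewrite inE; apply/forallP/eA.
by rewrite inE => /forallP.
Qed.

Lemma connect_orbit (G : {group {perm T}}) e x y :
    (forall a b, e a b -> b \in orbit 'P G a) ->
  connect e x y -> y \in orbit 'P G x.
Proof.
move=> eG /connectP[p]; elim: p x => [|z p IHp] x /= => [_ ->|]; first exact: orbit_refl.
by case/andP=> /eG xz pz /(IHp _ pz) zy; apply: orbit_trans zy xz.
Qed.

Lemma joint_orbits_partition s t : partition (joint_orbits s t) [set: T].
Proof. by apply/orbit_partition/subsetP=> g _; rewrite !inE /=; apply/subsetP=> x; rewrite !inE. Qed.

Lemma mem_pblock_joint_orbits s t x y :
  (y \in pblock (joint_orbits s t) x) = (y \in orbit 'P <<[set s; t]>> x).
Proof.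
have /and3P[_ tiP _] := joint_orbits_partition s t.
by rewrite (def_pblock tiP (imset_f _ (in_setT x))) ?orbit_refl.
Qed.

Lemma connect_equivalence e (D : {set T}) : connect_sym e -> {in D & &, equivalence_rel (connect e)}.
Proof.
move=> sym_e x y z _ _ _; split=> [|xy]; first exact: connect0.
by apply/idP/idP; apply: connect_trans; rewrite // sym_e.
Qed.

Lemma partition_eqP e P : connect_sym e -> partition P [set: T] ->
  reflect (forall x y, connect e x y = (y \in pblock P x))
          (equivalence_partition (connect e) [set: T] == P).
Proof.
move=> sym_e partP; apply: (iffP eqP) => [<- x y|eP].
  by rewrite pblock_equivalence_partition ?inE //; apply: connect_equivalence.
rewrite -[RHS](equivalence_partition_pblock partP) /equivalence_partition.
by apply: eq_in_imset => x _; apply/setP=> y; rewrite !inE eP.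
Qed.

Lemma refinesP s P : partition P [set: T] ->
  reflect (forall x, s x \in pblock P x) (refines (porbits s) P).
Proof.
move=> partP; case/and3P: (partP) => /eqP covP tiP _.
apply: (iffP forall_inP) => [ref x|sP _ /imsetP[x _ ->]].
  have /exists_inP[B PB /subsetP sub] := ref _ (imset_f _ (isT : x \in predT)).
  rewrite (def_pblock tiP PB (sub _ (porbit_id s x))).
  by apply: sub; rewrite -{1}(expg1 s) mem_porbit.
apply/exists_inP; exists (pblock P x); first by rewrite pblock_mem // covP inE.
apply/subsetP=> y /porbitP[i ->]; elim: i => [|i IHi].
  by rewrite perm1 mem_pblock covP inE.
by rewrite expgSr permM; move: IHi; rewrite -eq_pblockT // => /eqP->.
Qed.

Lemma join_rel_sym P Q : partition P [set: T] -> partition Q [set: T] ->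
  connect_sym [rel x y : T | (y \in pblock P x) || (y \in pblock Q x)].
Proof.
move=> partP partQ; apply: sym_connect_sym => x y /=.
by rewrite -!eq_pblockT // !(eq_sym (pblock _ x)).
Qed.

Lemma partition_join_oneP P Q (x0 : T) :
    partition P [set: T] -> partition Q [set: T] ->
  reflect (forall x y, connect [rel x y | (y \in pblock P x) || (y \in pblock Q x)] x y)
          (partition_join P Q == one_block_partition T).
Proof.
move=> partP partQ; set e := (X in connect X).
have part1 : partition (one_block_partition T) [set: T].
  apply/and3P; split; rewrite /one_block_partition.
  - by rewrite /cover big_set1.
  - exact: trivIset1.
  - by rewrite inE eq_sym; apply/set0Pn; exists x0; rewrite inE.
have pb1 x : pblock (one_block_partition T) x = [set: T].
  have /and3P[_ tiP _] := part1.
  by rewrite (def_pblock tiP (B := [set: T])) ?inE.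
apply: (iffP (partition_eqP (join_rel_sym partP partQ) part1)) => con x y.
  by rewrite con pb1 inE.
by rewrite con pb1 inE.
Qed.

Lemma transitive_orbitP (G : {group {perm T}}) (x0 : T) :
  reflect (forall x y, y \in orbit 'P G x) [transitive G, on [set: T] | 'P].
Proof.
apply: (iffP idP) => [tr x y|orb]; first by rewrite (atransP tr) ?inE.
by apply/imsetP; exists x0 => //; apply/setP=> y; rewrite inE orb.
Qed.

End GeneratedOrbits.

(** * Sorting factorizations by their orbit partition *)

Section OrbitPartition.
Local Open Scope group_scope.
Variable n : nat.
Implicit Types (s t nu : 'S_n) (P : {set {set 'I_n}}) (w : seq ('I_n * 'I_n)).

(** Generators move points inside an orbit of s, t or inside a block of [P]; conversely, every edge
    of the graph is realized by its own transposition. *)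
Lemma transitive_joinE s t w P (x0 : 'I_n) :
    partition P [set: 'I_n] ->
    (forall x y, connect (edge_rel w) x y = (y \in pblock P x)) ->
  [transitive <<[set s; t] :|: [set transp u | u in w]>>, on [set: 'I_n] | 'P] =
  (partition_join (joint_orbits s t) P == one_block_partition 'I_n).
Proof.
move=> partP wP; have partJ := joint_orbits_partition s t.
apply/(transitive_orbitP _ x0)/(partition_join_oneP x0 partJ partP) => [orb x y|con x y].
  apply: orbit_gen_connect (orb x y) => r; rewrite inE => /orP[rst|/imsetP[u uw ->]] z.
    apply: connect1 => /=; rewrite mem_pblock_joint_orbits.
    by apply/orP; left; apply/orbitP; exists r => //; rewrite mem_gen.
  apply: connect1 => /=; rewrite -wP; apply/orP; right.
  rewrite /transp; case: tpermP => [->|->|_ _]; rewrite ?connect0 //; apply: connect1.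
    by rewrite /edge_rel /= -surjective_pairing uw.
  by rewrite /edge_rel /= -surjective_pairing uw orbT.
apply: connect_orbit (con x y) => a b /= /orP[].
  rewrite mem_pblock_joint_orbits => /orbitP[g gst <-]; apply/orbitP; exists g => //.
  by apply: subsetP gst; rewrite genS // subsetUl.
rewrite -wP; apply: connect_orbit => c d; rewrite /edge_rel /= => cd.
apply/orbitP; exists (tperm c d); last by rewrite /= apermE tpermL.
rewrite mem_gen // inE; apply/orP; right; apply/imsetP.
case/orP: cd => cd; first by exists (c, d).
by exists (d, c); rewrite // /transp tpermC.
Qed.

Definition factorizations nu P l :=
  [set mu : l.-tuple ('I_n * 'I_n) |
    [&& monotone_transps mu, tperms mu == nu &
        equivalence_partition (connect (edge_rel mu)) [set: 'I_n] == P]].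

(** The components of the graph of a factorization form a partition coarser than the cycles of the
    product, since a product of transpositions moves points within components. *)
Lemma p_C_sum_partitions s t l : 0 < n ->
  p_C s t l =
  \sum_(P : {set {set 'I_n}} |
      [&& partition P [set: 'I_n], refines (porbits (s * t^-1)) P &
          partition_join (joint_orbits s t) P == one_block_partition 'I_n])
    #|factorizations (s * t^-1) P l|.
Proof.
move=> n0; pose x0 := Ordinal n0; rewrite /p_C -sum1_card.
pose orb (mu : l.-tuple ('I_n * 'I_n)) :=
  equivalence_partition (connect (edge_rel mu)) [set: 'I_n].
have partO mu : partition (orb mu) [set: 'I_n].
  exact/equivalence_partitionP/connect_equivalence/edge_connect_sym.
have orbE (mu : l.-tuple _) x y : connect (edge_rel mu) x y = (y \in pblock (orb mu) x).
  by move: x y; apply/(partition_eqP (edge_connect_sym mu)).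
have prodE (mu : l.-tuple _) :
    (s == (\prod_(u <- mu) transp u) * t) = (tperms mu == s * t^-1).
  by rewrite eq_sym -(inj_eq (mulIg t^-1)) mulgK.
rewrite (partition_big orb (fun P => [&& partition P [set: 'I_n],
  refines (porbits (s * t^-1)) P &
  partition_join (joint_orbits s t) P == one_block_partition 'I_n])); last first.
  move=> mu; rewrite inE prodE (transitive_joinE _ _ x0 (partO mu) (orbE mu)).
  case/and3P=> _ /eqP prod_mu ->; rewrite partO andbT /=.
  by apply/(refinesP _ (partO mu)) => x; rewrite -orbE -prod_mu tperms_connect.
apply: eq_bigr => P /and3P[partP refP joinP]; rewrite sum1_card.
apply: eq_card => mu; rewrite unfold_in !inE prodE -!andbA.
do 3!congr (_ && _); rewrite -/(orb mu) andbC.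
case: eqP => //= orbP.
by rewrite (transitive_joinE _ _ x0 (partO mu) (orbE mu)) orbP joinP.
Qed.

End OrbitPartition.

(** * Cutting a monotone factorization into its blocks *)

Section Interleaving.
Variables (S : eqType) (C : eqType) (val_max : S -> nat) (color : S -> C).
Implicit Types (w : seq S).
Let le_max u v := val_max u <= val_max v.

(** If the first letters had different colors, each would occur later in the other word, so
    sortedness would give them equal maxima and thus the same color. *)
Lemma sorted_interleaving_inj w1 w2 :
    sorted le_max w1 -> sorted le_max w2 ->
    (forall u v, u \in w1 -> v \in w2 -> val_max u = val_max v -> color u = color v) ->
    (forall k, [seq u <- w1 | color u == k] = [seq u <- w2 | color u == k]) ->
  w1 = w2.
Proof.
have tr : transitive le_max by move=> x y z; apply: leq_trans.
elim: w1 w2 => [|u w1 IHw1] [|v w2] //.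
- by move=> _ _ _ /(_ (color v)); rewrite /= eqxx.
- by move=> _ _ _ /(_ (color u)); rewrite /= eqxx.
rewrite /= !(path_sortedE tr) => /andP[/allP leu srt1] /andP[/allP lev srt2] eqc eqf.
have [cuv|cuv] := eqVneq (color u) (color v).
  have := eqf (color u); rewrite cuv eqxx => -[uv eq_tl]; subst v.
  congr (_ :: _); apply: IHw1 => //.
    by move=> x y xw yw; apply: eqc; rewrite inE ?xw ?yw orbT.
  by move=> k; have := eqf k; case: ifP => // _ [].
have uw2 : u \in w2.
  have : u \in [seq x <- v :: w2 | color x == color u].
    by rewrite -/(filter _ (v :: w2)) /= -eqf eqxx mem_head.
  rewrite mem_filter inE => /andP[_ /predU1P[uv|//]].
  by rewrite uv eqxx in cuv.
have vw1 : v \in w1.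
  have : v \in [seq x <- u :: w1 | color x == color v].
    by rewrite -/(filter _ (u :: w1)) /= eqf eqxx mem_head.
  rewrite mem_filter inE => /andP[_ /predU1P[uv|//]].
  by rewrite uv eqxx in cuv.
have uv : val_max u = val_max v.
  by apply/anti_leq/andP; split; [apply: leu | apply: lev].
by rewrite (eqc u v (mem_head _ _) (mem_head _ _) uv) eqxx in cuv.
Qed.

End Interleaving.

Section Decomposition.
Local Open Scope group_scope.
Variable n : nat.
Implicit Types (nu : 'S_n) (P : {set {set 'I_n}}) (w : seq ('I_n * 'I_n)).

(** Testing one end suffices for words whose letters have both ends in the same block. *)
Definition block_word (B : {set 'I_n}) w := [seq u <- w | u.1 \in B].

Definition block_factorization nu (B : {set 'I_n}) w :=
  [&& monotone_transps w, all (fun u => (u.1 \in B) && (u.2 \in B)) w,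
      tperms w == restr_perm B nu &
      [forall x in B, forall y in B, connect (edge_rel w) x y]].

(** Letters outside [B] fix [B] pointwise, and letters inside [B] fix its complement pointwise. *)
Lemma tperms_block_word (B : {set 'I_n}) w x :
    (forall u, u \in w -> (u.1 \in B) = (u.2 \in B)) ->
  tperms (block_word B w) x = if x \in B then tperms w x else x.
Proof.
elim: w x => [|u w IHw] x wB; first by rewrite /tperms big_nil perm1; case: ifP.
have {}IHw y := IHw y (fun v vw => wB v (mem_behead (s := u :: w) vw)).
have uB := wB u (mem_head _ _).
rewrite /block_word /=; case: ifP => u1B; last first.
  rewrite IHw; case: ifP => xB //; rewrite /tperms big_cons permM.
  by rewrite tpermD //; apply: contraTneq xB => <-; rewrite -?uB u1B.
rewrite /tperms !big_cons !permM -!/(tperms _) IHw.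
have -> : (tperm u.1 u.2 x \in B) = (x \in B).
  by case: tpermP => [->|->|//]; rewrite -?uB.
case: ifP => // xB; rewrite tpermD //; apply: contraFneq xB => <-; by rewrite -?uB.
Qed.

Lemma connect_block_word (B : {set 'I_n}) w x y :
    (forall u, u \in w -> (u.1 \in B) = (u.2 \in B)) ->
  x \in B -> connect (edge_rel w) x y -> connect (edge_rel (block_word B w)) x y.
Proof.
move=> wB xB /connectP[p]; elim: p x xB => [|z p IHp] x xB /= => [_ ->|].
  exact: connect0.
case/andP=> xz pz yE.
have zB : z \in B by case/orP: xz => /wB /=; rewrite xB.
apply: connect_trans (IHp z zB pz yE); apply: connect1.
by rewrite /edge_rel /= !mem_filter /= xB zB.
Qed.

Lemma monotone_block_word (B : {set 'I_n}) w : monotone_transps w -> monotone_transps (block_word B w).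
Proof.
case/andP=> alw srt; rewrite /monotone_transps all_filter sorted_filter //.
  by rewrite andbT; apply: sub_all alw => u uu; apply/implyP.
by move=> a b c; apply: leq_trans.
Qed.

Lemma mem_pblockE P (B : {set 'I_n}) x : partition P [set: 'I_n] -> B \in P ->
  (x \in B) = (pblock P x == B).
Proof.
case/and3P=> /eqP covP tiP _ PB; apply/idP/eqP=> [|<-]; first exact: def_pblock.
by rewrite mem_pblock covP inE.
Qed.

Lemma perm_stab nu P (B : {set 'I_n}) : partition P [set: 'I_n] -> (forall x, nu x \in pblock P x) ->
  B \in P -> nu \in 'N(B | 'P).
Proof.
move=> partP nuP PB; apply/astabsP=> x; rewrite /= apermE !(mem_pblockE _ partP PB).
by have := nuP x; rewrite -eq_pblockT // => /eqP->.
Qed.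

Lemma sum_block_word_size P w : partition P [set: 'I_n] ->
  \sum_(B : {B : {set 'I_n} | B \in P}) size (block_word (val B) w) = size w.
Proof.
move=> partP; case/and3P: (partP) => /eqP covP _ _; elim: w => [|u w IHw].
  by rewrite big1.
have pbu : pblock P u.1 \in P by rewrite pblock_mem // covP inE.
rewrite /= -{}IHw (bigD1 (Sub (pblock P u.1) pbu)) //= [in RHS](bigD1 (Sub (pblock P u.1) pbu)) //=.
rewrite mem_pblock covP inE /= addSn; congr (_ + _).+1.
apply: eq_bigr => B neB; rewrite /block_word /= (mem_pblockE _ partP (valP B)).
by case: eqP => // pB; case/eqP: neB; apply: val_inj.
Qed.

(** Cutting into block words is injective by [sorted_interleaving_inj]; conversely, pieces are glued
    by concatenating them and sorting by maxima. Bounding the pieces by [l] keeps the families in a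
    finite type. *)
Lemma factorizations_blockwise nu P l :
    partition P [set: 'I_n] -> (forall x, nu x \in pblock P x) ->
  #|factorizations nu P l| =
  #|[set F : {ffun {B : {set 'I_n} | B \in P} -> l.-bseq ('I_n * 'I_n)} |
      [forall B, block_factorization nu (val B) (F B)] && (\sum_B size (F B) == l)]|.
Proof.
move=> partP nuP; case/and3P: (partP) => /eqP covP tiP P0.
have pbP x : pblock P x \in P by rewrite pblock_mem // covP inE.
pose le_max (u v : 'I_n * 'I_n) := u.2 <= v.2.
have tr : transitive le_max by move=> x y z; apply: leq_trans.
have tot : total le_max by move=> x y; apply: leq_total.
have block2 w (u : 'I_n * 'I_n) :
    (forall x y, connect (edge_rel w) x y = (y \in pblock P x)) ->
    u \in w -> pblock P u.1 = pblock P u.2.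
  move=> wP uw; apply/eqP; rewrite eq_pblockT // -wP; apply: connect1.
  by rewrite /edge_rel /= -surjective_pairing uw.
(* A block word is no longer than [mu], so the default of [insub_bseq] is never reached. *)
pose split (mu : l.-tuple ('I_n * 'I_n)) :=
  [ffun B : {B : {set 'I_n} | B \in P} => insub_bseq l (block_word (val B) mu)].
have splitE (mu : l.-tuple ('I_n * 'I_n)) B : split mu B = block_word (val B) mu :> seq _.
  rewrite ffunE /insub_bseq val_insubd size_filter.
  by rewrite (leq_trans (count_size _ _)) ?size_tuple.
have split_inj : {in factorizations nu P l &, injective split}.
  move=> mu1 mu2; rewrite !inE => /and3P[/andP[_ srt1] _ /(partition_eqP (edge_connect_sym _) partP) P1].
  case/and3P=> /andP[_ srt2] _ /(partition_eqP (edge_connect_sym _) partP) P2 eq_split.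
  apply: val_inj; apply: (sorted_interleaving_inj (val_max := fun u => val u.2)
     (color := fun u => pblock P u.1) srt1 srt2).
    move=> u v u1 v2 /val_inj uv.
    by rewrite (block2 _ _ P1 u1) (block2 _ _ P2 v2) uv.
  move=> k; have [Pk|nPk] := boolP (k \in P); last first.
    rewrite !(@eq_filter _ _ pred0) ?filter_pred0 // => u;
      by apply/negbTE; apply: contraNneq nPk => <-.
  have : split mu1 (Sub k Pk) = split mu2 (Sub k Pk) :> seq _ by rewrite eq_split.
  rewrite !splitE /block_word /= => eqk.
  by rewrite -!(eq_filter (fun u => mem_pblockE u.1 partP Pk)).
rewrite -(card_in_imset split_inj); apply: eq_card => F; rewrite inE.
apply/imsetP/andP=> [[mu] | [/forallP validF /eqP sizeF]].
  rewrite inE => /and3P[mono /eqP prod_mu /(partition_eqP (edge_connect_sym _) partP) muP] ->.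
  split; last first.
    by under eq_bigr do rewrite splitE; rewrite sum_block_word_size // size_tuple.
  apply/forallP=> B; rewrite splitE.
  have wB u : u \in tval mu -> (u.1 \in val B) = (u.2 \in val B).
    by move/(block2 _ _ muP)=> uu; rewrite !(mem_pblockE _ partP (valP B)) uu.
  apply/and4P; split.
  - exact: monotone_block_word.
  - by apply/allP=> u; rewrite mem_filter => /andP[uB /wB <-]; rewrite uB.
  - apply/eqP/permP=> x; rewrite tperms_block_word // prod_mu.
    have stab := perm_stab partP nuP (valP B).
    case: ifP => xB; first by rewrite restr_permE.
    by rewrite (out_perm (restr_perm_on _ _)) ?xB.
  - apply/forall_inP=> x xB; apply/forall_inP=> y yB.
    apply: connect_block_word => //; rewrite muP -eq_pblockT //.
    by move: xB yB; rewrite !(mem_pblockE _ partP (valP B)) => /eqP-> /eqP->.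
(* Stability of sort keeps the order of the letters within each block. *)
pose mu0 := flatten [seq (F B : seq _) | B <- enum {: {B : {set 'I_n} | B \in P}}].
pose mu := sort le_max mu0.
have size_mu : size mu == l.
  rewrite size_sort size_flatten /shape -map_comp sumnE big_map.
  by rewrite -[X in _ == X]sizeF big_enum.
have memF B u : u \in (F B : seq _) -> (u.1 \in val B) && (u.2 \in val B).
  by case/and4P: (validF B) => _ /allP alB _ _ /alB.
have mem_mu u : u \in mu -> exists B, u \in (F B : seq _).
  by rewrite mem_sort => /flattenP[_ /mapP[B _ ->] uB]; exists B.
have block_mu B : block_word (val B) mu = F B.
  rewrite /block_word filter_sort // filter_flatten -map_comp.
  rewrite [X in sort _ X](_ : _ = F B :> seq _); last first.
    (* Blocks are disjoint: the filter keeps the piece of [B] whole and empties all others. *)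
    rewrite (eq_map (g := fun B' => if B' == B then (F B : seq _) else [::])) => [|B' /=].
      elim: (enum _) (enum_uniq {: {B : {set 'I_n} | B \in P}}) (mem_enum predT B) => //= B' s IHs.
      case/andP=> B's us; rewrite inE eq_sym; case: eqP => [BB' _|_] /=; last exact: IHs.
      rewrite BB' in B's; elim: s B's {IHs us} => [|B2 s IHs]; first by rewrite cats0.
      by rewrite inE negb_or => /andP[B2B Bs] /=; rewrite eq_sym (negbTE B2B) IHs.
    case: eqP => [->|B'B].
      by apply/all_filterP/allP=> u /memF /andP[].
    apply/eqP; rewrite -[_ == _]negbK -has_filter; apply/hasPn=> u /memF /andP[uB' _].
    apply/negP=> uB; apply: B'B; apply: val_inj.
    by rewrite -(def_pblock tiP (valP B') uB') -(def_pblock tiP (valP B) uB).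
  rewrite sorted_sort //; by case/and4P: (validF B) => /andP[].
have wB (B : {B : {set 'I_n} | B \in P}) u : u \in mu -> (u.1 \in val B) = (u.2 \in val B).
  case/mem_mu=> B' /memF /andP[u1 u2]; rewrite !(mem_pblockE _ partP (valP B)).
  by rewrite (def_pblock tiP (valP B') u1) (def_pblock tiP (valP B') u2).
have muP x y : connect (edge_rel mu) x y = (y \in pblock P x).
  apply/idP/idP=> [|yx].
    case/connectP=> p; elim: p x => [|z p IHp] x /= => [_ ->|].
      by rewrite mem_pblock covP inE.
    case/andP=> xz pz /(IHp _ pz).
    have [B /andP[xB zB]] : exists B : {B : {set 'I_n} | B \in P}, (x \in val B) && (z \in val B).
      by case/orP: xz => /mem_mu[B /memF]; exists B; rewrite // andbC.
    by rewrite (def_pblock tiP (valP B) xB) (def_pblock tiP (valP B) zB).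
  pose B : {B : {set 'I_n} | B \in P} := Sub (pblock P x) (pbP x).
  have /and4P[_ _ _ /forall_inP conB] := validF B.
  have xB : x \in val B by rewrite /= mem_pblock covP inE.
  have := forall_inP (conB x xB) y yx.
  rewrite -block_mu; apply: connect_sub => a b ab; apply: connect1.
  by move: ab; rewrite /edge_rel /= !mem_filter => /orP[/andP[_ ->]//|/andP[_ ->]]; rewrite orbT.
exists (Tuple size_mu); last first.
  by apply/ffunP=> B; apply: val_inj; rewrite /= splitE block_mu.
rewrite inE /=; apply/and3P; split.
- apply/andP; split; last exact: sort_sorted.
  apply/allP=> u /mem_mu[B uB]; case/and4P: (validF B) => /andP[/allP alB _] _ _ _.
  exact: alB.
(* At [x] only the letters of the block of [x] matter, and their product is the restriction of
   [nu]. *)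
- apply/eqP/permP=> x.
  pose B : {B : {set 'I_n} | B \in P} := Sub (pblock P x) (pbP x).
  have xB : x \in val B by rewrite /= mem_pblock covP inE.
  have := tperms_block_word x (wB B); rewrite xB => <-; rewrite block_mu.
  case/and4P: (validF B) => _ _ /eqP-> _; rewrite restr_permE //.
  exact: perm_stab (valP B).
- exact/(partition_eqP (edge_connect_sym _) partP).
Qed.

End Decomposition.

Lemma p_C1_connectE n (nu : 'S_n) l : 0 < n ->
  p_C nu 1%g l =
  #|[set mu : l.-tuple ('I_n * 'I_n) |
      [&& monotone_transps mu, tperms mu == nu &
          [forall x, forall y, connect (edge_rel mu) x y]]]|.
Proof.
move=> n0; apply: eq_card => mu; rewrite !inE mulg1 eq_sym; congr (_ && _).
rewrite -/(tperms mu); case: eqP => //= prod_mu.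
apply/(transitive_orbitP _ (Ordinal n0))/forallP => [orb x|con x y].
  apply/forallP=> y; apply: orbit_gen_connect (orb x y) => r; rewrite !inE.
  case/orP=> [/orP[]/eqP-> z|/imsetP[u umu ->] z].
  - by rewrite -prod_mu tperms_connect.
  - by rewrite perm1 connect0.
  rewrite /transp; case: tpermP => [->|->|_ _]; rewrite ?connect0 //; apply: connect1.
    by rewrite /edge_rel /= -surjective_pairing umu.
  by rewrite /edge_rel /= -surjective_pairing umu orbT.
apply: connect_orbit (forallP (con x) y) => c d; rewrite /edge_rel /= => cd.
apply/orbitP; exists (tperm c d); last by rewrite /= apermE tpermL.
rewrite mem_gen // inE; apply/orP; right; apply/imsetP.
case/orP: cd => cd; first by exists (c, d).
by exists (d, c); rewrite // /transp tpermC.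
Qed.

(** * Restriction to a block *)

Section Transport.
Local Open Scope group_scope.
Variables (n : nat) (nu : 'S_n) (B : {set 'I_n}).
Hypothesis B_stab : nu \in 'N(B | 'P).

Let f : 'I_#|B| -> 'I_n := enum_val.
Let fB i : f i \in B. Proof. exact: enum_valP. Qed.
Let f_inj : injective f. Proof. exact: enum_val_inj. Qed.
Let phi (u : 'I_#|B| * 'I_#|B|) := (f u.1, f u.2).

Let phi_inj : injective phi.
Proof. by move=> [a b] [c d] [/f_inj-> /f_inj->]. Qed.

(** The enumeration of [B] filters that of ['I_n], hence is increasing; this is why relabelling
    preserves monotonicity. *)
Lemma enum_val_ltn (i j : 'I_#|B|) : (enum_val i < enum_val j) = (i < j).
Proof.
have srt : sorted (fun i j : 'I_n => i < j) (enum B).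
  rewrite /enum_mem -enumT; apply: sorted_filter; last exact: enum_ord_sorted.
  by move=> a b c; apply: ltn_trans.
have homo (a b : 'I_#|B|) : a < b -> enum_val a < enum_val b.
  have [x0 _] : exists x0 : 'I_n, true by exists (enum_val a).
  move=> ab; rewrite !(enum_val_nth x0).
  by apply: (sorted_ltn_nth _ _ srt) => //; rewrite ?inE -?cardE // => x y z; apply: ltn_trans.
case: (ltngtP i j) => [/homo //|/homo|/val_inj->]; last by rewrite ltnn.
by move=> /ltnW; rewrite leqNgt => /negbTE.
Qed.

Lemma monotone_map_enum_val w : monotone_transps (map phi w) = monotone_transps w.
Proof.
rewrite /monotone_transps all_map sorted_map; congr (_ && _).
  by apply: eq_all => u /=; rewrite enum_val_ltn.
by case: w => //= u w; apply: eq_path => a b /=; rewrite leqNgt enum_val_ltn -leqNgt.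
Qed.

Lemma tperms_map_enum_val w i : tperms (map phi w) (f i) = f (tperms w i).
Proof.
rewrite /tperms; elim: w i => [|u w IHw] i; first by rewrite !big_nil !perm1.
by rewrite /= !big_cons !permM /= -inj_tperm // IHw.
Qed.

Lemma edge_rel_map_enum_val w i j : edge_rel (map phi w) (f i) (f j) = edge_rel w i j.
Proof.
by rewrite /edge_rel /= -[(f i, f j)]/(phi (i, j)) -[(f j, f i)]/(phi (j, i)) !mem_map.
Qed.

Lemma connect_map_enum_val w i j :
  connect (edge_rel (map phi w)) (f i) (f j) = connect (edge_rel w) i j.
Proof.
apply/idP/idP; last first.
  case/connectP=> p; elim: p i => [|k p IHp] i /= => [_ ->|]; first exact: connect0.
  case/andP=> ik pk /(IHp _ pk); apply: connect_trans; apply: connect1.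
  by rewrite edge_rel_map_enum_val.
case/connectP=> p; elim: p i => [|z p IHp] i /=.
  by move=> _ ji; rewrite (f_inj ji) connect0.
case/andP=> iz pz jE.
have [k zk] : exists k, z = f k.
  by case/orP: iz => /mapP[[a b] _ [ea eb]]; [exists b | exists a].
move: iz pz; rewrite zk edge_rel_map_enum_val => ik pk; rewrite zk in jE.
by apply: connect_trans (connect1 ik) (IHp _ pk jE).
Qed.

Lemma block_word_map_enum_val w : block_word B (map phi w) = map phi w.
Proof. by apply/all_filterP/allP=> _ /mapP[u _ ->] /=. Qed.

Variable nu' : 'S_#|B|.
Hypothesis nu'E : forall i, f (nu' i) = nu (f i).

Lemma block_factorization_map_enum_val w :
  block_factorization nu B (map phi w) =
  [&& monotone_transps w, tperms w == nu' & [forall x, forall y, connect (edge_rel w) x y]].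
Proof.
rewrite /block_factorization monotone_map_enum_val; congr (_ && _).
have -> /= : all (fun u => (u.1 \in B) && (u.2 \in B)) (map phi w).
  by apply/allP=> _ /mapP[u _ ->] /=; rewrite !fB.
congr (_ && _).
  apply/eqP/eqP=> [prod_w|prod_w]; apply/permP.
    move=> i; apply: f_inj; rewrite -tperms_map_enum_val prod_w nu'E.
    by rewrite restr_permE.
  move=> x; have [xB|xB] := boolP (x \in B).
    rewrite restr_permE // -(enum_rankK_in xB xB) -/(f _).
    by rewrite tperms_map_enum_val prod_w nu'E.
  rewrite (out_perm (restr_perm_on _ _)) // -block_word_map_enum_val.
  rewrite tperms_block_word ?(negbTE xB) // => _ /mapP[u _ ->] /=.
  by rewrite !fB.
apply/forall_inP/forallP=> con.
  move=> i; apply/forallP=> j; rewrite -connect_map_enum_val.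
  exact: (forall_inP (con _ (fB i)) _ (fB j)).
move=> x xB; apply/forall_inP=> y yB.
rewrite -(enum_rankK_in xB xB) -(enum_rankK_in xB yB) -!/(f _).
by rewrite connect_map_enum_val; apply: (forallP (con _)).
Qed.

Lemma block_factorization_ex w : 0 < #|B| -> block_factorization nu B w ->
  exists w', w = map phi w'.
Proof.
move=> /card_gt0P[x0 x0B] /and4P[_ /allP wB _ _].
exists [seq (enum_rank_in x0B u.1, enum_rank_in x0B u.2) | u <- w].
rewrite -map_comp -[LHS]map_id; apply/eq_in_map => u /wB /andP[u1 u2].
by rewrite /= /phi /= /f !enum_rankK_in // -surjective_pairing.
Qed.

(** Every factorization on [B] comes from its relabelling on ['I_#|B|]; [k <= l] makes it fit into
    the bounded sequences. *)
Lemma card_block_factorizations l k : 0 < #|B| -> k <= l ->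
  #|[set w : l.-bseq ('I_n * 'I_n) | block_factorization nu B w && (size w == k)]| =
  p_C nu' 1 k.
Proof.
move=> B0 kl; rewrite p_C1_connectE //.
pose h (mu : k.-tuple _) := insub_bseq l (map phi mu).
have hE (mu : k.-tuple _) : h mu = map phi mu :> seq _.
  by rewrite /h /insub_bseq val_insubd size_map size_tuple kl.
have h_inj : injective h.
  move=> mu1 mu2 eq_h; apply/val_inj/(inj_map phi_inj).
  by rewrite /= -!hE eq_h.
rewrite -[RHS](card_imset _ h_inj); apply: eq_card => w; rewrite inE.
apply/andP/imsetP=> [[fw /eqP sz]|[mu muS ->]].
  have [w' ww'] := block_factorization_ex B0 fw.
  have sz' : size w' == k by rewrite -sz ww' size_map.
  exists (Tuple sz'); last by apply: val_inj; rewrite /= hE.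
  by rewrite inE /= -block_factorization_map_enum_val -ww'.
rewrite hE size_map size_tuple block_factorization_map_enum_val.
by rewrite inE in muS.
Qed.

Lemma restr_perm_expg i k : (restr_perm B nu ^+ k) (f i) = f ((nu' ^+ k) i).
Proof.
elim: k => [|k IHk]; first by rewrite !perm1.
by rewrite !expgSr !permM IHk restr_permE // nu'E.
Qed.

Lemma restr_cycle_typeE : restr_cycle_type nu B = cycle_type nu'.
Proof.
have porbE i : porbit (restr_perm B nu) (f i) = f @: porbit nu' i.
  apply/setP=> x; apply/porbitP/imsetP=> [[k ->]|[j /porbitP[k ->] ->]].
    by exists ((nu' ^+ k) i); rewrite ?mem_porbit ?restr_perm_expg.
  by exists k; rewrite restr_perm_expg.
have imE : porbit (restr_perm B nu) @: B = (fun C : {set 'I_#|B|} => f @: C) @: porbits nu'.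
  apply/setP=> C; apply/imsetP/imsetP=> [[x xB ->]|[_ /imsetP[i _ ->] ->]].
    exists (porbit nu' (enum_rank_in xB x)); first exact: imset_f.
    by rewrite -porbE /f enum_rankK_in.
  by exists (f i).
apply/(perm_sortP geq_total geq_trans geq_anti); rewrite imE.
have /(perm_map (fun C : {set 'I_n} => #|C|)) :
    perm_eq (enum ((fun C : {set 'I_#|B|} => f @: C) @: porbits nu'))
            (map (fun C : {set 'I_#|B|} => f @: C) (enum (porbits nu'))).
  apply: uniq_perm; rewrite ?enum_uniq //.
    by rewrite map_inj_uniq ?enum_uniq //; apply: imset_inj.
  move=> C; rewrite mem_enum; apply/imsetP/mapP=> -[D DP ->]; exists D => //.
    by rewrite mem_enum.
  by rewrite mem_enum in DP.
move/perm_trans; apply; rewrite -map_comp.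
rewrite (@eq_map _ _ _ (fun C : {set 'I_#|B|} => #|C|)) // => C /=.
by rewrite card_imset.
Qed.

End Transport.

Lemma restr_perm_transport n (nu : 'S_n) (B : {set 'I_n}) : (nu \in 'N(B | 'P))%g ->
  exists nu' : 'S_#|B|, forall i, enum_val (nu' i) = nu (enum_val i).
Proof.
move=> stab; have nuB x : x \in B -> nu x \in B.
  by move=> xB; have := astabsP stab x; rewrite /= apermE xB.
pose g (i : 'I_#|B|) := enum_rank_in (nuB _ (enum_valP i)) (nu (enum_val i)).
have gE i : enum_val (g i) = nu (enum_val i) by rewrite enum_rankK_in // nuB // enum_valP.
have g_inj : injective g.
  by move=> i j /(congr1 enum_val); rewrite !gE => /perm_inj/enum_val_inj.
by exists (perm g_inj) => i; rewrite permE gE.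
Qed.

(** * Lengths and numbers of the pieces on one block *)

Section BlockCounts.
Local Open Scope group_scope.
Variables (n : nat) (nu : 'S_n) (B : {set 'I_n}).
Hypotheses (B_stab : nu \in 'N(B | 'P)) (B_gt0 : 0 < #|B|).
Local Notation c := (restr_cycle_type nu B).

Lemma block_factorization_genus w : block_factorization nu B w ->
  exists g, size w + 2 = size c + #|B| + 2 * g.
Proof.
have [nu' nu'E] := restr_perm_transport B_stab => fw.
have [w' ww'] := block_factorization_ex B_gt0 fw.
move: fw; rewrite ww' (block_factorization_map_enum_val B_stab nu'E).
case/and3P=> /andP[/allP lt_w _] /eqP prod_w /forallP con.
have [||x y|g gE] := @tperms_genus _ w'.
- by rewrite card_ord.
- by apply/allP=> u /lt_w; rewrite neq_ltn => ->.
- exact/forallP/con.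
exists g; rewrite size_map gE prod_w (restr_cycle_typeE B_stab nu'E) size_cycle_type card_ord.
by rewrite (addnC #|B|).
Qed.

Lemma card_block_factorizations_hurwitz l g : size c + #|B| + 2 * g - 2 <= l ->
  (#|[set w : l.-bseq ('I_n * 'I_n) | block_factorization nu B w
      && (size w == size c + #|B| + 2 * g - 2)%N]|%:R
   = (single_hurwitz #|B| g c)%:R / #|perm_class #|B| c|%:R :> rat)%R.
Proof.
have [nu' nu'E] := restr_perm_transport B_stab => le_l.
rewrite (card_block_factorizations B_stab nu'E) //.
by rewrite (single_hurwitz_class _ (esym (restr_cycle_typeE B_stab nu'E))).
Qed.

Lemma size_restr_cycle_type : size c = #|porbit nu @: B|.
Proof.
rewrite size_sort size_map -cardE; congr #|pred_of_set _|.
apply: eq_in_imset => x xB; apply/setP=> y.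
have powE k : (restr_perm B nu ^+ k) x = (nu ^+ k) x /\ (nu ^+ k) x \in B.
  elim: k => [|k [IHk xkB]]; first by rewrite !perm1.
  rewrite !expgSr !permM IHk restr_permE //; split=> //.
  by have := astabsP B_stab ((nu ^+ k) x); rewrite /= apermE xkB.
by apply/porbitP/porbitP=> -[k ->]; exists k; rewrite (powE k).1.
Qed.

End BlockCounts.

(** Each cycle of [nu] lies in exactly one block. *)
Lemma sum_size_restr_cycle_type n (nu : 'S_n) (P : {set {set 'I_n}}) :
    partition P [set: 'I_n] -> (forall x, nu x \in pblock P x) ->
  \sum_(B : {B : {set 'I_n} | B \in P}) size (restr_cycle_type nu (val B)) = ncycles nu.
Proof.
move=> partP nuP; case/and3P: (partP) => /eqP covP tiP _.
have pbP x : pblock P x \in P by rewrite pblock_mem // covP inE.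
transitivity (\sum_(B : {B : {set 'I_n} | B \in P})
   \sum_(C in porbits nu) (C \in porbit nu @: val B)).
  apply: eq_bigr => B _; rewrite size_restr_cycle_type; last exact: perm_stab (valP B).
  rewrite -sum1_card big_mkcond [RHS]big_mkcond /=; apply: eq_bigr => C _.
  case: ifP => CB; last by case: ifP.
  by have /imsetP[x _ ->] := CB; rewrite imset_f.
rewrite exchange_big /= /ncycles -sum1_card; apply: eq_bigr => _ /imsetP[x _ ->].
pose B0 : {B : {set 'I_n} | B \in P} := Sub (pblock P x) (pbP x).
rewrite (bigD1 B0) //= imset_f ?mem_pblock ?covP ?inE // big1 ?addn0 // => B neB.
apply/eqP; rewrite eqb0; apply: contra neB => /imsetP[y yB /eqP].
rewrite eq_porbit_mem porbit_sym => /porbitP[k yk]; apply/eqP/val_inj => /=.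
apply/esym/eqP; rewrite -(mem_pblockE _ partP (valP B)).
have stab k' : ((nu ^+ k')%g x \in val B) = (x \in val B).
  elim: k' => [|k' <-]; first by rewrite perm1.
  rewrite expgSr permM.
  by have := astabsP (perm_stab partP nuP (valP B)) ((nu ^+ k')%g x); rewrite /= apermE.
by rewrite -(stab k) -yk.
Qed.

(** * All factorizations with a given orbit partition *)

Section PartitionCount.
Variables (n : nat) (nu : 'S_n) (P : {set {set 'I_n}}) (l : nat).
Hypotheses (partP : partition P [set: 'I_n]) (nuP : forall x, nu x \in pblock P x).
Local Notation block := {B : {set 'I_n} | B \in P}.

(** A piece of genus g on [B] has length [base B + 2 * g - 2]. *)
Let base (B : block) : nat := size (restr_cycle_type nu (val B)) + #|val B|.

Let block_stab (B : block) : (nu \in 'N(val B | 'P))%g.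
Proof. exact: perm_stab (valP B). Qed.

Let block_gt0 (B : block) : 0 < #|val B|.
Proof.
case/and3P: partP => _ _ P0; rewrite lt0n cards_eq0.
by apply: contraNneq P0 => <-; apply: valP.
Qed.

(** Ensures that the subtraction in the length of a piece does not truncate. *)
Let base_ge2 B : 2 <= base B.
Proof.
rewrite /base size_restr_cycle_type ?block_stab //.
apply: (@leq_add 1 1); last exact: block_gt0.
have /card_gt0P[x xB] := block_gt0 B.
by apply/card_gt0P; exists (porbit nu x); apply: imset_f.
Qed.

Let sum_base : \sum_B base B = ncycles nu + n.
Proof.
rewrite /base big_split /= sum_size_restr_cycle_type //; congr (_ + _).
rewrite -(big_sub P (fun B : {set 'I_n} => #|B|)).
by rewrite -(card_partition partP) cardsT card_ord.
Qed.

Let card_block : #|{: block}| = #|P|.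
Proof. by rewrite card_sig; apply: eq_card => B; rewrite inE. Qed.

Let gen (B : block) (w : seq ('I_n * 'I_n)) := (size w + 2 - base B)./2.

Let genE (B : block) w : block_factorization nu (val B) w -> size w + 2 = base B + 2 * gen B w.
Proof.
move=> /(block_factorization_genus (block_stab B) (block_gt0 B))[g gE].
by rewrite /gen gE -/(base B) addKn !mul2n doubleK.
Qed.

Let valid_family (F : {ffun block -> l.-bseq ('I_n * 'I_n)}) :=
  [forall B, block_factorization nu (val B) (F B)] && (\sum_B size (F B) == l).

(** The Riemann-Hurwitz formulas of the blocks, added up. *)
Let sum_genus F : valid_family F ->
  l + 2 * #|P| = ncycles nu + n + 2 * \sum_B gen B (F B).
Proof.
case/andP=> /forallP validF /eqP sizeF.
rewrite -[in LHS]sizeF -sum_base big_distrr -big_split /= -card_block mulnC.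
rewrite -sum_nat_const -big_split; apply: eq_bigr => B _.
exact: genE.
Qed.

(** Excludes factorizations when the prescribed total genus would be negative. *)
Lemma factorizations_genus : 0 < #|factorizations nu P l| ->
  exists k, l + 2 * #|P| = ncycles nu + n + 2 * k.
Proof.
rewrite factorizations_blockwise // => /card_gt0P[F]; rewrite inE => /sum_genus eq_l.
by exists (\sum_B gen B (F B)).
Qed.

(** Families of pieces are sorted by their genera. Fixing the genera fixes all lengths, after which
    the pieces are chosen independently and the count is a product over the blocks. *)
Lemma card_factorizations_hurwitz k :
    l + 2 * #|P| = ncycles nu + n + 2 * k ->
  (#|factorizations nu P l|%:R =
  \sum_(g in genus_families P k%:Z)
    \prod_(B : block)
      let c := restr_cycle_type nu (val B) in
      (single_hurwitz #|val B| (g B) c)%:R / #|perm_class #|val B| c|%:R :> rat)%R.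
Proof.
move=> lE; rewrite factorizations_blockwise //.
(* The genera of a valid family add up to [k], so each fits into ['I_k.+1] and [inord] loses
   nothing. *)
pose gF (F : {ffun block -> l.-bseq ('I_n * 'I_n)}) : {ffun block -> 'I_k.+1} :=
  [ffun B => inord (gen B (F B))].
have sum_gen F : valid_family F -> \sum_B gen B (F B) = k.
  by move/sum_genus; rewrite lE => /eqP; rewrite eqn_add2l eqn_pmul2l // => /eqP.
have gFE F B : valid_family F -> gF F B = gen B (F B) :> nat.
  move=> vF; rewrite ffunE inordK // ltnS -(sum_gen _ vF) (bigD1 B) //=.
  exact: leq_addr.
rewrite -sum1_card natr_sum.
rewrite (partition_big gF (fun g => g \in genus_families P k%:Z)) /=; last first.
  move=> F; rewrite inE => vF; rewrite inE; apply/eqP; congr Posz.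
  by apply: etrans (sum_gen _ vF); apply: eq_bigr => B _; rewrite gFE.
apply: eq_bigr => g; rewrite inE => /eqP[sum_g].
have sum_len : \sum_B (base B + 2 * g B - 2) = l.
  apply/eqP; rewrite -(eqn_add2r (2 * #|P|)) lE -sum_base.
  rewrite -card_block mulnC -sum_nat_const -big_split -[X in _ == _ + 2 * X]sum_g.
  rewrite big_distrr -big_split; apply/eqP; apply: eq_bigr => B _ /=; rewrite subnK //.
  exact: leq_trans (base_ge2 B) (leq_addr _ _).
have le_len B : base B + 2 * g B - 2 <= l.
  by rewrite -sum_len (bigD1 B) //= leq_addr.
(* Expanding this product by distributivity gives one term per family of pieces of the prescribed
   lengths. *)
transitivity (\prod_(B : block) \sum_(w : l.-bseq ('I_n * 'I_n) |
    block_factorization nu (val B) w && (size w == base B + 2 * g B - 2)%N) (1 : rat))%R.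
  rewrite bigA_distr_big_dep /=; apply: eq_big => F; last by rewrite big1.
  rewrite inE -/(valid_family F); apply/andP/familyP=> [[vF /eqP gE] B|FB].
    case/andP: (vF) => /forallP validF _; rewrite unfold_in validF /=.
    have := genE (validF B); rewrite -(gFE _ B vF) gE => <-.
    by rewrite addnK.
  have {}FB B : block_factorization nu (val B) (F B) /\ size (F B) = base B + 2 * g B - 2.
    by have := FB B; rewrite unfold_in => /andP[? /eqP].
  have vF : valid_family F.
    apply/andP; split; first by apply/forallP=> B; have [] := FB B.
    by rewrite -[X in _ == X]sum_len; apply/eqP/eq_bigr => B _; have [] := FB B.
  split=> //; apply/eqP/ffunP=> B; apply: val_inj; rewrite /= gFE //.
  have [_ szB] := FB B; rewrite /gen szB subnK ?addKn ?mul2n ?doubleK //.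
  exact: leq_trans (base_ge2 B) (leq_addr _ _).
apply: eq_bigr => B _ /=.
rewrite -(card_block_factorizations_hurwitz (block_stab B) (block_gt0 B) (le_len B)).
by rewrite -sum1_card natr_sum; apply: eq_bigl => w; rewrite inE.
Qed.

End PartitionCount.

(** * The contribution of one pair of permutations *)

Lemma ncycles_gt0 n (s : 'S_n) : 0 < n -> 0 < ncycles s.
Proof. by move=> n0; apply/card_gt0P; exists (porbit s (Ordinal n0)); apply: imset_f. Qed.

Local Open Scope ring_scope.

(** For a given partition the condition on #(nu) - |pi| determines L, so the sum over L is moved
    inside and has at most one term. *)
Lemma p_C_hurwitz (h n : nat) (s t : 'S_n) : (0 < n)%N ->
  let nu : 'S_n := (s * t^-1)%g in
  let d : int := h%:Z - genus s t^-1%g in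
  (p_C s t (ncycles s + ncycles t + 2 * h - 2))%:R =
    \sum_(L < (`|d|%N).+1 | L%:Z <= d)
      \sum_(P : {set {set 'I_n}} |
          [&& partition P [set: 'I_n], refines (porbits nu) P,
              partition_join (joint_orbits s t) P
                == one_block_partition 'I_n &
              (ncycles nu)%:Z - #|P|%:Z
                == #|joint_orbits s t|%:Z + L%:Z - 1])
        \sum_(g in genus_families P (d - L%:Z))
          \prod_(B : {B : {set 'I_n} | B \in P})
            let c := restr_cycle_type nu (val B) in
            (single_hurwitz #|val B| (g B) c)%:R
              / #|perm_class #|val B| c|%:R :> rat.
Proof.
move=> n0 nu d; set l := (_ + _ - _)%N.
rewrite p_C_sum_partitions // natr_sum -/nu.
rewrite (exchange_big_dep (fun P : {set {set 'I_n}} =>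
  [&& partition P [set: 'I_n], refines (porbits nu) P &
      partition_join (joint_orbits s t) P == one_block_partition 'I_n])) /=; last first.
  by move=> L P _ /and4P[-> -> ->].
apply: eq_bigr => P /and3P[partP refP joinP].
have nuP := elimT (refinesP _ partP) refP.
have := genusP s t; rewrite -/nu card_ord => genusE.
have lE : (l + 2 = ncycles s + ncycles t + 2 * h)%N.
  have := ncycles_gt0 s n0; have := ncycles_gt0 t n0; rewrite /l; lia.
pose J := #|joint_orbits s t|.
have le_m : (J + #|P| <= ncycles nu + 1)%N.
  apply: (leq_card_connected_partitions (joint_orbits_partition s t) partP) => //.
    move=> x; rewrite mem_pblock_joint_orbits; apply/orbitP; exists nu => //.
    by rewrite groupM ?groupV // mem_gen // !inE eqxx ?orbT.
  exact/(partition_join_oneP (Ordinal n0) (joint_orbits_partition s t) partP).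
(* The only possible value of L; by [le_m] the subtraction is exact. *)
pose m := (ncycles nu + 1 - (J + #|P|))%N.
transitivity (\sum_(g in genus_families P (d - m%:Z))
          \prod_(B : {B : {set 'I_n} | B \in P})
            (let c := restr_cycle_type nu (val B) in
            (single_hurwitz #|val B| (g B) c)%:R
              / #|perm_class #|val B| c|%:R : rat)).
  (* [d - m] is the total genus of the pieces. If it is negative there are no factorizations, and no
     genus families either. *)
  case Ek: (d - m%:Z) => [k|k].
    by apply: card_factorizations_hurwitz => //; move: Ek; rewrite /d /m; move: genusE; rewrite -/J; lia.
  have -> : #|factorizations nu P l| = 0%N.
    apply/eqP; rewrite -leqn0 leqNgt; apply/negP=> /(factorizations_genus partP nuP)[k' k'E].
    by move: Ek; rewrite /d /m; move: genusE; rewrite -/J; lia.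
  by rewrite big_pred0 // => g; rewrite inE.
have condE (L : nat) : ((ncycles nu)%:Z - #|P|%:Z == J%:Z + L%:Z - 1) = (L == m).
  by rewrite /m; apply/eqP/eqP; lia.
(* If [m] exceeds [d], no L is admissible and both sides are empty sums. *)
have [le_d|gt_d] := boolP (m%:Z <= d).
  have m_lt : (m < (`|d|%N).+1)%N by lia.
  rewrite (big_pred1 (Ordinal m_lt)) // => L.
  rewrite partP refP joinP condE /= -val_eqE /=.
  by case: eqP => [->|_]; rewrite ?le_d ?andbF.
rewrite [RHS]big_pred0 => [|L].
  rewrite big_pred0 // => g; rewrite inE; apply/negbTE/eqP.
  by move: gt_d; lia.
rewrite partP refP joinP condE /=.
by case: eqP => [->|_]; rewrite ?(negbTE gt_d) ?andbF.
Qed.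


Theorem theorem4p5 (h n : nat) (a b : seq nat) (n_gt0 : (0 < n)%N)
    (a_part : is_intpart n a) (b_part : is_intpart n b) :
  (double_hurwitz n h a b)%:R =
  \sum_(s in perm_class n a) \sum_(t in perm_class n b)
    let nu : 'S_n := (s * t^-1)%g in
    let d : int := h%:Z - genus s t^-1%g in
    \sum_(L < (`|d|%N).+1 | L%:Z <= d)
      \sum_(P : {set {set 'I_n}} |
          [&& partition P [set: 'I_n], refines (porbits nu) P,
              partition_join (joint_orbits s t) P
                == one_block_partition 'I_n &
              (ncycles nu)%:Z - #|P|%:Z
                == #|joint_orbits s t|%:Z + L%:Z - 1])
        \sum_(g in genus_families P (d - L%:Z))
          \prod_(B : {B : {set 'I_n} | B \in P})
            let c := restr_cycle_type nu (val B) in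
            (single_hurwitz #|val B| (g B) c)%:R
              / #|perm_class #|val B| c|%:R :> rat.
Proof.
rewrite /double_hurwitz natr_sum; apply: eq_bigr => s; rewrite inE => /eqP <-.
rewrite natr_sum; apply: eq_bigr => t; rewrite inE => /eqP <-.
by rewrite !size_cycle_type p_C_hurwitz.
Qed.
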